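(* For any $\delta>0$, the Adaptive Double Exploration (ADE) algorithm, run with confidence parameter $\delta$ on the outlier detection bandit problem with $n$ arms and threshold $\theta=\mu_y+k\sigma_y$, returns the correct outlier set $O^*=\{i\in[n]: y_i\ge\theta\}$ with probability at least $1-\delta$.
   Context: **Problem.** There are $n$ arms $[n]=\{1,\dots,n\}$. The reward distribution of arm $i$ is bounded in $[a,b]$ with $a\ge 0$ and has mean $y_i$ (unknown to the learner). Each pull of arm $i$ yields a sample from its distribution, independent of the past pulls. Put $R=b-a$, $R'=b^2-a^2$, $\mu_y=\frac1n\sum_{i=1}^n y_i$, $\sigma_y=\sqrt{\frac1n\sum_{i=1}^n(y_i-\mu_y)^2}$, and $\theta=\mu_y+k\sigma_y$, where $k$ is a given constant. The outlier set is $O^*=\{i\in[n]:y_i\ge\theta\}$. **Two kinds of sampling.** *Random sample for the threshold*: choose an arm uniformly at random from $[n]$ and pull it twice independently; the $l$-th such sample gives a pair $(x_{l,1},x_{l,2})$. *Sequential sample*: pull once each arm in the current candidate set; the $l$-th sequential pull of arm $i$ gives reward $y_{i,l}$. **Estimators and radii.** $m_{\theta,t}$ and $m_{a,t}$ are the numbers of random samples and of sequential samples performed prior to round $t$, and $m_{i,t}$ is the number of sequential pulls of arm $i$ prior to round $t$ (so $m_{i,t}=m_{a,t}$ while $i$ is a candidate). Let $\delta_t=\frac{3\delta}{(n+4)\pi^2t^2}$, and, with $m=m_{\theta,t}$, $$\hat y_{i,t}=\frac1{m_{i,t}}\sum_{l=1}^{m_{i,t}}y_{i,l},\qquad \hat\mu_{y,t}=\frac1m\sum_{l=1}^m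 x_{l,1},$$ $$\hat\sigma_{y,t}=\sqrt{\Big|\frac1m\sum_{l=1}^m x_{l,1}x_{l,2}-\frac1{m^2}\sum_{l=1}^m\sum_{h=1}^m x_{l,1}x_{h,2}\Big|},\qquad \hat\theta_t=\hat\mu_{y,t}+k\hat\sigma_{y,t},$$ $$r_{i,t}=R\sqrt{\frac{\log(1/\delta_t)}{2m_{i,t}}},\qquad r_{a,t}=R\sqrt{\frac{\log(1/\delta_t)}{2m_{a,t}}},\qquad \epsilon_{\sigma,t}=(R'+2bR)\sqrt{\frac{\log(1/\delta_t)}{2m_{\theta,t}}},$$ $$U_{\sigma,t}=\min_{1\le\tau\le t}\{\hat\sigma_{y,\tau}^2+\epsilon_{\sigma,\tau}\},\qquad r_{\theta,t}=\Big(R+\sqrt2\,k\,\frac{R'+2bR}{\sqrt{U_{\sigma,t}}}\Big)\sqrt{\frac{\log(1/\delta_t)}{2m_{\theta,t}}},$$ where expressions with a zero sample count in the denominator are read as $+\infty$ (so they do not affect the minimum). **ADE algorithm.** Initialize $N=O=\emptyset$, $t=1$, $m_{\theta,1}=m_{a,1}=0$. Perform one random sample and increment $t$; then perform one sequential sample with candidate set $[n]$ and increment $t$; set $S_t=[n]$. While $S_t\ne\emptyset$: if $r_{a,t}\le r_{\theta,t}$, perform one random sample (from all $n$ arms); otherwise perform one sequential sample on the candidate set $S_t$. Increment $t$ by one, and update the estimators and radii. Then, starting from $S_t=S_{t-1}$, for each $i\in S_{t-1}$: if $\hat y_{i,t}+r_{i,t}\le\hat\theta_t-r_{\theta,t}$,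 add $i$ to $N$ (normal arms) and remove it from $S_t$; else if $\hat y_{i,t}-r_{i,t}\ge\hat\theta_t+r_{\theta,t}$, add $i$ to $O$ (outliers) and remove it from $S_t$. When $S_t=\emptyset$, stop and return $O$.
   Formalization: Assumes a<b (else a radius is 0/0) and k≥0 (for k<0 the radius can be negative and arms are misclassified). Returning O* is proved if no mean equals θ (a tied arm stops the algorithm from ending); with ties, any returned set is O* with probability at least 1−δ. *)

(* Defs.v *)
From HB Require Import structures.
From mathcomp Require Import all_boot all_order all_algebra finmap.
From mathcomp Require Import all_classical all_reals all_analysis.

Set Implicit Arguments.
Unset Strict Implicit.
Unset Printing Implicit Defensive.
Import Order.TTheory GRing.Theory Num.Theory.
Local Open Scope classical_set_scope.
Local Open Scope ring_scope.

Definition mutually_independent d (T : measurableType d) (R : realType)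
    (P : probability T R) (I : choiceType) (F : I -> set_system T) : Prop :=
  forall (J : {fset I}) (E : I -> set T), (forall j, j \in J -> F j (E j)) ->
    P (\big[setI/setT]_(j <- J) E j) = (\prod_(j <- J) P (E j))%E.

Section Problem.
Context {R : realType} {n : nat}.
Variable nu : 'I_n -> probability (measurableTypeR R) R.

Definition arm_mean (i : 'I_n) : R := \int[nu i]_z z.

Definition mu_y : R := n%:R^-1 * \sum_(i < n) arm_mean i.

Definition sigma_y : R :=
  Num.sqrt (n%:R^-1 * \sum_(i < n) (arm_mean i - mu_y) ^+ 2).

Definition threshold (k : R) : R := mu_y + k * sigma_y.

Definition outliers (k : R) : {set 'I_n} :=
  [set i | threshold k <= arm_mean i]%SET.

(* [A l] is the arm drawn for the l-th random sample, [(x1 l, x2 l)] its two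
   rewards, and [y i l] the reward of the l-th sequential pull of arm [i].
   Samples are numbered from 0.  The rewards [y i l] form an infinite i.i.d.
   sequence for each arm, of which a run of the algorithm reads a prefix. *)
Record sampling d (T : measurableType d) (P : probability T R)
    (A : nat -> T -> 'I_n) (x1 x2 : nat -> {RV P >-> R})
    (y : 'I_n -> nat -> {RV P >-> R}) : Prop := Sampling {
  arm_choice_measurable : forall l i, measurable (A l @^-1` [set i]);
  random_sample_law : forall l i (B1 B2 : set R),
    measurable B1 -> measurable B2 ->
    P (A l @^-1` [set i] `&` x1 l @^-1` B1 `&` x2 l @^-1` B2) =
      ((n%:R^-1)%:E * nu i B1 * nu i B2)%E;
  sequential_sample_law : forall i l (B : set R),
    measurable B -> P (y i l @^-1` B) = nu i B;
  samples_independent :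
    mutually_independent P (fun j : nat + 'I_n * nat =>
      match j with
      | inl l =>
          (* the sigma-algebra generated by (A l, x1 l, x2 l) *)
          [set E | exists B : 'I_n -> set (R * R),
             (forall i, measurable (B i)) /\
             E = [set w | B (A l w) (x1 l w, x2 l w)]]
      | inr (i, l) => preimage_set_system setT (y i l) measurable
      end)
}.

End Problem.

(* The state at the beginning of round t.  [mtheta] is the list
   m_{theta,1}, ..., m_{theta,t}, so that its size is the round t. *)
Record state (n : nat) := State {
  mtheta : seq nat;
  mseq : nat;
  marm : {ffun 'I_n -> nat};
  cand : {set 'I_n};
  normal_set : {set 'I_n};
  outlier_set : {set 'I_n}
}.

Section ADE.
Context {R : realType} {n : nat}.
Variables (a b k delta : R).
(* the realized rewards *)
Variables (x : nat -> R * R) (y : 'I_n -> nat -> R).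

Implicit Types (st : state n) (t m : nat) (i : 'I_n).

Definition width : R := b - a.
Definition width_sq : R := b ^+ 2 - a ^+ 2.

Definition delta_ t : R := 3 * delta / ((n + 4)%:R * pi ^+ 2 * t%:R ^+ 2).

Definition arm_estimate i m : R := m%:R^-1 * \sum_(l < m) y i l.

Definition mu_hat m : R := m%:R^-1 * \sum_(l < m) (x l).1.

Definition sigma_hat m : R :=
  Num.sqrt `| m%:R^-1 * \sum_(l < m) (x l).1 * (x l).2
              - (m%:R ^+ 2)^-1 * \sum_(l < m) \sum_(h < m) (x l).1 * (x h).2 |.

Definition theta_hat m : R := mu_hat m + k * sigma_hat m.

Definition conf_radius (c : R) t m : \bar R :=
  if m == 0%N then +oo%E
  else (c * Num.sqrt (ln (1 / delta_ t) / (2 * m%:R)))%:E.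

Definition eps_sigma t m : \bar R := conf_radius (width_sq + 2 * b * width) t m.

Definition round st : nat := size (mtheta st).

Definition mtheta_at st (tau : nat) : nat := nth 0%N (mtheta st) tau.-1.

Definition mtheta_now st : nat := mtheta_at st (round st).

Definition U_sigma st : \bar R :=
  \big[mine/+oo%E]_(1 <= tau < (round st).+1)
    ((sigma_hat (mtheta_at st tau) ^+ 2)%:E
     + eps_sigma tau (mtheta_at st tau))%E.

Definition r_arm st i : \bar R := conf_radius width (round st) (marm st i).

Definition r_seq st : \bar R := conf_radius width (round st) (mseq st).

(* [U_sigma st] is finite as soon as one random sample has been performed. *)
Definition r_theta st : \bar R :=
  conf_radius (width + Num.sqrt 2 * k * ((width_sq + 2 * b * width)
                                    / Num.sqrt (fine (U_sigma st))))
    (round st) (mtheta_now st).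

Definition random_sample st : state n :=
  State (rcons (mtheta st) (mtheta_now st).+1) (mseq st) (marm st)
    (cand st) (normal_set st) (outlier_set st).

Definition sequential_sample st : state n :=
  State (rcons (mtheta st) (mtheta_now st)) (mseq st).+1
    [ffun i => (marm st i + (i \in cand st))%N]
    (cand st) (normal_set st) (outlier_set st).

Definition is_normal st i : bool :=
  ((arm_estimate i (marm st i))%:E + r_arm st i
    <= (theta_hat (mtheta_now st))%:E - r_theta st)%E.

Definition is_outlier st i : bool :=
  ~~ is_normal st i &&
  ((theta_hat (mtheta_now st))%:E + r_theta st
    <= (arm_estimate i (marm st i))%:E - r_arm st i)%E.

Definition classify st : state n :=
  State (mtheta st) (mseq st) (marm st)
    [set i in cand st | ~~ is_normal st i && ~~ is_outlier st i]%SET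
    (normal_set st :|: [set i in cand st | is_normal st i])%SET
    (outlier_set st :|: [set i in cand st | is_outlier st i])%SET.

Definition initial : state n :=
  sequential_sample (random_sample
    (State [:: 0%N] 0 [ffun=> 0%N] [set: 'I_n]%SET finset.set0 finset.set0)).

Definition loop_body st : state n :=
  classify (if (r_seq st <= r_theta st)%E
            then random_sample st else sequential_sample st).

Definition ADE_state (j : nat) : state n :=
  iter j (fun st => if cand st == finset.set0 then st else loop_body st) initial.

Definition ADE_returns (O : {set 'I_n}) : Prop :=
  exists j, cand (ADE_state j) = finset.set0 /\ outlier_set (ADE_state j) = O.

End ADE.

(* Main.v *)
Require Import Defs.
From HB Require Import structures.
From mathcomp Require Import all_boot all_order all_algebra finmap.
From mathcomp Require Import all_classical all_reals all_analysis.
From mathcomp Require Import measurable_realfun ring lra.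

Set Implicit Arguments.
Unset Strict Implicit.
Unset Printing Implicit Defensive.
Import Order.TTheory GRing.Theory Num.Theory.
Import numFieldNormedType.Exports.
Local Open Scope classical_set_scope.
Local Open Scope ring_scope.

(* No arm is misclassified as long as every estimator lies within its radius of
   its target.  The sample counts used in round t are random but smaller than t,
   and the radii grow with t for a fixed count, so the deviations need only be
   excluded for the pairs (t, m) = (m + 1, m): a union bound over the counts m
   replaces one over rounds and random counts.  Hoeffding's inequality bounds
   each of them by 2 delta_{m+1}, and sum_{t >= 2} 1/t^2 <= 2/3 makes the total
   at most delta.  The radius of theta follows from
   |s' - s| = |s'^2 - s^2| / (s' + s), with U <= s'^2 + epsilon by definition.
   If no mean equals theta, the run stops: U is at least of order m_theta^(-1/2),
   so the test of the loop keeps m_a of order at least m_theta^(1/2), and both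
   radii tend to 0. *)

(** * Hoeffding's inequality *)

(** Hoeffding's inequality is applied to n + 3 families of averages: the rewards of each arm, the
    first rewards of the random samples, their second rewards, and the products of the two. The
    standard deviation is not an average, but the double sum in its estimator factors, so these
    averages control it. The two rewards of a random sample share their arm and are independent only
    given that arm; hence their product has as its mean the average of the squared arm means, which
    is what a variance needs. Probability is confined to these averages. Outside one failure event
    the analysis of a run is deterministic, on a fixed outcome with plain sequences of rewards. The
    run depends on the outcome in a complicated way, but its state ranges over a countable type,
    which makes events about it measurable. An arm whose mean equals theta leaves no gap for the
    radii to fall below. Correctness of a returned set is therefore kept apart from termination. *)

Lemma derive_ge0_ge_at0 (R : realType) (f df : R -> R) :
  (forall x : R, 0 <= x -> is_derive x 1 f (df x)) ->
  (forall x, 0 <= x -> 0 <= df x) -> forall x : R, 0 <= x -> f 0 <= f x.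
Proof.
move=> fdf df0 x x0.
apply: (@ger0_derive1_ndecry R f 0) => //.
- by move=> z; rewrite in_itv/= andbT => /ltW /fdf [].
- move=> z; rewrite in_itv/= andbT => /ltW z0.
  by rewrite derive1E; have [_ ->] := fdf _ z0; exact: df0.
- apply: derivable_within_continuous => z; rewrite in_itv/= andbT => /fdf.
  by case.
Qed.

(** The left side is the moment generating function of a Bernoulli variable. With [D] that function
    of x and q = p e^x / D, the difference g = p x + x^2 / 8 - ln D vanishes at 0 together with its
    derivative p + x / 4 - q, and its second derivative 1/4 - q (1 - q) is nonnegative because it is
    a square divided by 4 D^2. *)
Lemma two_point_mgf_le (R : realType) (p h : R) : 0 <= p <= 1 -> 0 <= h ->
  1 - p + p * expR h <= expR (p * h + h ^+ 2 / 8).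
Proof.
move=> /andP[p0 p1] h0.
pose D x : R := 1 - p + p * expR x.
have D0 x : 0 < D x.
  rewrite /D; have [->|p_neq0] := eqVneq p 0; first by rewrite subr0 mul0r addr0.
  by rewrite ltr_wpDl ?subr_ge0// mulr_gt0 ?expR_gt0// lt_def p_neq0.
have dD (x : R) : is_derive x 1 D (p * expR x).
  apply: (is_derive_eq (is_deriveD (is_derive_cst (1 - p) x 1)
    (is_deriveZ p (is_derive_expR x)))).
  by rewrite add0r.
pose q x : R := p * expR x / D x.
have dq (x : R) : is_derive x 1 (fun z => p + z / 4 - q z)
    (4^-1 - p * expR x * (1 - p) / D x ^+ 2).
  have dV := is_deriveV (lt0r_neq0 (D0 x)) (dD x).
  have dlin := is_deriveD (is_derive_cst p x 1) (is_deriveZ 4^-1 (is_derive_id x 1)).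
  have dM := is_deriveM (is_deriveZ p (is_derive_expR x)) dV.
  rewrite (_ : (fun z => _) = cst p + 4^-1 *: id - p *: expR * (fun z => (D z)^-1));
    last by apply/funext => z /=; rewrite mulrC.
  apply: (is_derive_eq (is_deriveB dlin dM)).
  rewrite add0r /GRing.scale /= !mulr1.
  have := lt0r_neq0 (D0 x); rewrite -exprVn /D => ?.
  rewrite -[p *: expR x]/(p * expR x); field; exact: lt0r_neq0 (D0 x).
have q_le x : 0 <= x -> 0 <= p + x / 4 - q x.
  move=> x0; apply: le_trans (derive_ge0_ge_at0 (fun z _ => dq z) _ x0).
    rewrite /q /D expR0 !mulr1 mul0r addr0 subrK divr1 subrr//.
  move=> z _; rewrite subr_ge0 ler_pdivrMr ?exprn_gt0//.
  rewrite -subr_ge0 (_ : _ - _ = (p * expR z - (1 - p)) ^+ 2 / 4).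
    by rewrite divr_ge0// sqr_ge0.
  by rewrite /D; field.
pose g x := p * x + x ^+ 2 / 8 - ln (D x).
have dg (x : R) : is_derive x 1 g (p + x / 4 - q x).
  have dl := is_derive1_comp (is_derive1_ln (D0 x)) (dD x).
  have dlin := is_deriveD (is_deriveZ p (is_derive_id x 1))
     (is_deriveZ 8^-1 (is_deriveX 2 (is_derive_id x 1))).
  rewrite (_ : g = p *: id + 8^-1 *: (id ^+ 2) - (@ln R \o D)); last first.
    by apply/funext => z /=; rewrite /g [_ / 8]mulrC.
  have dall := is_deriveB dlin dl.
  apply: (is_derive_eq dall).
  rewrite /q /GRing.scale /=; field; exact: lt0r_neq0 (D0 x).
have := derive_ge0_ge_at0 (fun z _ => dg z) q_le h0.
rewrite /g {1}/D expR0 mulr1 subrK ln1 mulr0 expr0n mul0r addr0 subr0 subr_ge0.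
by rewrite -ler_expR lnK ?posrE.
Qed.

(** Convexity, read off the tangent of the exponential at [s * x]: it lies below the graph at both
    ends, and in the weighted sum of the two inequalities the first-order terms cancel. *)
Lemma expR_chord (R : realType) (lo hi s x : R) : lo < hi -> lo <= x <= hi ->
  expR (s * x) <= ((hi - x) * expR (s * lo) + (x - lo) * expR (s * hi)) / (hi - lo).
Proof.
move=> lohi /andP[lox xhi]; rewrite ler_pdivlMr ?subr_gt0//.
have tangent u : expR (s * x) * (1 + (s * u - s * x)) <= expR (s * u).
  rewrite -[in leRHS](subrKC (s * x) (s * u)) expRD ler_pM2l ?expR_gt0//.
  exact: expR_ge1Dx.
have h1 : (x - lo) * _ <= _ := ler_wpM2l _ (tangent hi).
have h2 : (hi - x) * _ <= _ := ler_wpM2l _ (tangent lo).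
rewrite subr_ge0 in h1; rewrite subr_ge0 in h2.
have {}h1 := h1 lox; have {}h2 := h2 xhi.
apply: le_trans (lerD h2 h1); rewrite le_eqVlt; apply/orP; left; apply/eqP.
by ring.
Qed.

(** The left side belongs to the law on the two points [lo] and [hi] with mean [m]. Taking out the
    factor [expR (s * lo)] leaves the Bernoulli case with p = (m - lo) / (hi - lo) and h = s (hi -
    lo). *)
Lemma hoeffding_mgf_le (R : realType) (lo hi m s : R) :
  lo < hi -> lo <= m <= hi -> 0 <= s ->
  ((hi - m) * expR (s * lo) + (m - lo) * expR (s * hi)) / (hi - lo) <=
    expR (s * m + s ^+ 2 * (hi - lo) ^+ 2 / 8).
Proof.
move=> lohi /andP[lom mhi] s0; have w0 : 0 < hi - lo by rewrite subr_gt0.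
pose p := (m - lo) / (hi - lo).
have p01 : 0 <= p <= 1.
  by rewrite /p divr_ge0 ?subr_ge0//= ?ler_pdivrMr ?mul1r ?lerD2r// ltW.
have h0 : 0 <= s * (hi - lo) by rewrite mulr_ge0// ltW.
have := ler_wpM2l (expR_ge0 (s * lo)) (two_point_mgf_le p01 h0).
rewrite -expRD => le1; apply: (le_trans _ (le_trans le1 _)).
  rewrite (_ : s * hi = s * lo + s * (hi - lo)) ?expRD; last by ring.
  rewrite le_eqVlt; apply/orP; left; apply/eqP; rewrite /p.
  by field; exact: lt0r_neq0.
rewrite ler_expR le_eqVlt; apply/orP; left; apply/eqP; rewrite /p.
by field; exact: lt0r_neq0.
Qed.

(** * Independence and expectations of products *)

Section independence.
Local Open Scope ereal_scope.
Import HBNNSimple.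

(** Two measures that agree on measurable sets give the same integrals of nonnegative functions:
    here the image under [X] of [mu] with density [Z], and [c] times the law of [X2]. The weight [Z]
    lets a product of several factors be treated one factor at a time, the others being stored in
    [Z]. *)
Lemma ge0_integral_transfer (R : realType) d d2 d' (T : measurableType d)
    (T2 : measurableType d2) (S : measurableType d')
    (mu : {measure set T -> \bar R}) (mu2 : {measure set T2 -> \bar R})
    (X : T -> S) (X2 : T2 -> S) (Z : T -> R) (c : \bar R) (f : S -> \bar R) :
  measurable_fun setT X -> measurable_fun setT X2 -> measurable_fun setT Z ->
  (forall w, (0 <= Z w)%R) -> 0 <= c -> c \is a fin_num ->
  (forall B, measurable B ->
    \int[mu]_w ((Z w)%:E * (\1_B (X w))%:E) = c * mu2 (X2 @^-1` B)) ->
  measurable_fun setT f -> (forall s, 0 <= f s) ->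
  \int[mu]_w ((Z w)%:E * f (X w)) = c * \int[mu2]_w f (X2 w).
Proof.
move=> mX mX2 mZ Z0 c0 cfin ZXB mf f0.
have mZE : measurable_fun setT (EFin \o Z) by exact/measurable_EFinP.
have ind_comp r (g : {nnsfun S >-> R}) : measurable (g @^-1` [set r]) by [].
have simple (g : {nnsfun S >-> R}) :
    \int[mu]_w ((Z w)%:E * (g (X w))%:E) = c * \int[mu2]_w (g (X2 w))%:E.
  under eq_integral => w _.
    rewrite fimfunE -fsumEFin// ge0_mule_fsumr; last first.
      by move=> r; rewrite EFinM nnfun_muleindic_ge0.
    over.
  rewrite ge0_integral_fsum//; last 2 first.
  - move=> r; apply: emeasurable_funM => //; apply/measurable_EFinP.
    apply: measurable_funM => //.
    exact: (measurableT_comp (measurable_indic (ind_comp r g)) mX).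
  - by move=> r w _; apply: mule_ge0; [rewrite lee_fin|rewrite EFinM nnfun_muleindic_ge0].
  under [in RHS]eq_integral do rewrite fimfunE -fsumEFin//.
  rewrite [in RHS]ge0_integral_fsum//; last 2 first.
  - move=> r; apply/measurable_EFinP; apply: measurable_funM => //.
    exact: (measurableT_comp (measurable_indic (ind_comp r g)) mX2).
  - by move=> r w _; rewrite EFinM nnfun_muleindic_ge0.
  rewrite ge0_mule_fsumr; last first.
    by move=> r; apply: integral_ge0 => w _; rewrite EFinM nnfun_muleindic_ge0.
  apply: eq_fsbigr => r _.
  (* A nonnegative simple function takes no negative value, so such terms vanish on both sides; a
     nonnegative r can be taken out of the integrals. *)
  have [r0|r0] := ltP r 0%R.
    by rewrite preimage_nnfun0// !integral0_eq ?mule0// => w _;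
      rewrite indic0 mulr0 ?mule0.
  under eq_integral do rewrite EFinM muleCA.
  under [in RHS]eq_integral do rewrite EFinM.
  have mpre : measurable (X2 @^-1` (g @^-1` [set r])).
    by rewrite -[X2 @^-1` _]setTI; exact: mX2.
  rewrite !ge0_integralZl//.
  - rewrite ZXB// muleCA -[in LHS](setIT (X2 @^-1` _)) -integral_indic//.
  - apply: emeasurable_funM => //; apply/measurable_EFinP.
    exact: (measurableT_comp (measurable_indic (ind_comp r g)) mX).
  - by move=> w _; rewrite mule_ge0// lee_fin.
  - apply/measurable_EFinP.
    exact: (measurableT_comp (measurable_indic (ind_comp r g)) mX2).
(* From simple functions to [f] by monotone convergence on both sides. *)
pose f_ := nnsfun_approx measurableT mf.
have cvg_f s : (f_ k s)%:E @[k --> \oo] --> f s.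
  exact: (@cvg_nnsfun_approx _ _ _ _ measurableT _ mf (fun x _ => f0 x) s I).
have nd_f s : {homo (fun k => f_ k s) : i j / (i <= j)%N >-> (i <= j)%R}.
  by move=> i j ij; exact/lefP/nd_nnsfun_approx.
have mfX k : measurable_fun setT (fun w => (f_ k (X w))%:E).
  by apply/measurable_EFinP; exact: measurableT_comp.
have mfX2 k : measurable_fun setT (fun w => (f_ k (X2 w))%:E).
  by apply/measurable_EFinP; exact: measurableT_comp.
transitivity (limn (fun k => \int[mu]_w ((Z w)%:E * (f_ k (X w))%:E))).
  rewrite -monotone_convergence//=.
  - apply: eq_integral => w _; apply/esym/cvg_lim => //=.
    by apply: cvgeZl => //; exact: cvg_f.
  - by move=> k; apply: emeasurable_funM.
  - by move=> k w _; rewrite mule_ge0// lee_fin.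
  - by move=> w _ i j ij; apply: lee_wpmul2l; rewrite lee_fin //; exact: nd_f.
under eq_fun do rewrite simple.
rewrite (_ : \int[mu2]_w _ = limn (fun k => \int[mu2]_w (f_ k (X2 w))%:E)).
  by rewrite limeMl//; apply: ereal_nondecreasing_is_cvgn => i j ij;
    apply: ge0_le_integral => // w _; rewrite lee_fin ?nd_f.
rewrite -monotone_convergence//=.
- by apply: eq_integral => w _; apply/esym/cvg_lim => //=; exact: cvg_f.
- by move=> k w _; rewrite lee_fin.
- by move=> w _ i j ij; rewrite lee_fin nd_f.
Qed.

(** Initial segments are enough: choosing [B l] to be [setT] at the other indices gives the product
    formula for any finite set of indices. *)
Definition independent_seq d (T : measurableType d) (R : realType)
    (P : probability T R) (X : nat -> T -> R) : Prop :=
  forall N (B : nat -> set R), (forall l, measurable (B l)) ->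
    P (\big[setI/setT]_(l < N) (X l @^-1` B l)) =
      \prod_(l < N) P (X l @^-1` B l).

Lemma independent_expectation_prod d (T : measurableType d) (R : realType)
    (P : probability T R) (X : nat -> T -> R) N (g : nat -> R -> R) :
  (forall l, measurable_fun setT (X l)) -> independent_seq P X ->
  (forall l, measurable_fun setT (g l)) -> (forall l x, (0 <= g l x)%R) ->
  (forall l, \int[P]_w (g l (X l w))%:E < +oo) ->
  \int[P]_w (\prod_(l < N) g l (X l w))%R%:E =
    \prod_(l < N) \int[P]_w (g l (X l w))%:E.
Proof.
move=> mX indX.
(* Indicators are replaced by general functions one index at a time. *)
suff claim m : (m <= N)%N -> forall (g : nat -> R -> R),
    (forall l, measurable_fun setT (g l)) -> (forall l x, (0 <= g l x)%R) ->
    (forall l, \int[P]_w (g l (X l w))%:E < +oo) ->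
    (forall l, (m <= l < N)%N -> exists2 B, measurable B & g l = \1_B) ->
    \int[P]_w (\prod_(l < N) g l (X l w))%R%:E =
      \prod_(l < N) \int[P]_w (g l (X l w))%:E.
  move=> mg g0 goo; apply: (claim N) => // l /andP[Nl lN].
  by rewrite ltnNge Nl in lN.
elim: m => [_|m IH mN] {}g mg g0 goo gind.
  have /choice[B BP] : forall l, exists B, measurable B /\
      ((l < N)%N -> g l = \1_B).
    move=> l; have [lN|lN] := ltnP l N; last by exists setT; split.
    by have [B mB gB] := gind l lN; exists B; split.
  have mXB l : measurable (X l @^-1` B l).
    by rewrite -[X l @^-1` _]setTI; apply: mX => //; case: (BP l).
  have prod_ind M : (M <= N)%N -> forall w, (\prod_(l < M) g l (X l w))%R =
      \1_(\big[setI/setT]_(l < M) (X l @^-1` B l)) w.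
    elim: M => [_ w|M IHM MN w]; first by rewrite !big_ord0 indicT.
    rewrite !big_ord_recr/= indicI/= -IHM 1?ltnW//.
    by have [_ ->] := BP M.
  have mbig M : measurable (\big[setI/setT]_(l < M) (X l @^-1` B l)).
    by elim/big_ind : _ => // *; exact: measurableI.
  under eq_integral do rewrite prod_ind//.
  rewrite integral_indic// setIT [LHS](indX N B)//; last by move=> l; case: (BP l).
  apply: eq_bigr => l _.
  have [_ ->//] := BP l.
  rewrite -[in LHS](setIT (X l @^-1` _)) -integral_indic//.
pose im := Ordinal mN.
pose Z w : R := (\prod_(l < N | l != im) g l (X l w))%R.
pose c := \prod_(l < N | l != im) \int[P]_w (g l (X l w))%:E.
have int0 l : 0 <= \int[P]_w (g l (X l w))%:E.
  by apply: integral_ge0 => w _; rewrite lee_fin.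
rewrite (bigD1 im)//= muleC.
transitivity (\int[P]_w ((Z w)%:E * (g m (X m w))%:E)).
  by apply: eq_integral => w _; rewrite (bigD1 im)//= mulrC EFinM.
apply: (ge0_integral_transfer (X2 := X m) (f := EFin \o g m)) => //.
- rewrite /Z; under eq_fun do rewrite -big_filter.
  apply: measurable_prod => l _.
  exact: measurableT_comp.
- by move=> w; exact: prodr_ge0.
- exact: prode_ge0.
- by apply: prode_fin_num => l _; rewrite ge0_fin_numE.
(* With an indicator at index m, only the indices below m carry general functions, so the induction
   hypothesis applies; it is the hypothesis on sets of the transfer lemma, whose weight is the
   product of the other factors. *)
- move=> B mB; pose g' l := if l == m then \1_B else g l.
  have mg' l : measurable_fun setT (g' l) by rewrite /g'; case: ifP.
  have g'0 l x : (0 <= g' l x)%R by rewrite /g'; case: ifP.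
  have mXB : measurable (X m @^-1` B).
    by rewrite -[X m @^-1` _]setTI; exact: mX.
  have intB : \int[P]_w (\1_B (X m w))%:E = P (X m @^-1` B).
    by rewrite -[in RHS](setIT (X m @^-1` _)) -integral_indic.
  have := IH (ltnW mN) g' mg' g'0.
  have -> : \int[P]_w (\prod_(l < N) g' l (X l w))%R%:E =
      \int[P]_w ((Z w)%:E * (\1_B (X m w))%:E).
    apply: eq_integral => w _; rewrite (bigD1 im)//= mulrC EFinM {2}/g' eqxx.
    congr (_%:E * _); apply: eq_bigr => l lm; rewrite /g' ifN//.
  move=> ->.
  + rewrite (bigD1 im)//= muleC {2}/g' eqxx intB; congr (_ * _).
    by apply: eq_bigr => l lm; rewrite /g' ifN.
  + move=> l; rewrite /g'; case: eqP => [->|//].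
    by rewrite intB (le_lt_trans (probability_le1 _ _)) ?ltry.
  + move=> l /andP[ml lN]; rewrite /g'; case: eqP => [_|/eqP lm].
      by exists B.
    by apply: gind; rewrite lN andbT ltn_neqAle eq_sym lm.
- exact/measurable_EFinP.
- by move=> x; rewrite lee_fin.
Qed.

End independence.

(** * Chernoff bound for bounded variables *)

Section hoeffding.
Context d (T : measurableType d) (R : realType) (P : probability T R).

Lemma bounded_integrable (X : T -> R) (lo hi : R) :
  measurable_fun setT X -> (forall w, lo <= X w <= hi) ->
  P.-integrable setT (EFin \o X).
Proof.
move=> mX Xb.
apply: measurable_bounded_integrable => //.
  by rewrite (le_lt_trans (probability_le1 _ _)) ?ltry.
exists (`|lo| + `|hi|); split; first by rewrite num_real.
move=> M MX w _ /=; have /andP[loX Xhi] := Xb w.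
rewrite (le_trans _ (ltW MX))// ler_norml; apply/andP; split.
  by rewrite (le_trans _ loX)// lerNl (le_trans (ler_norm _))// normrN lerDl.
by rewrite (le_trans Xhi)// (le_trans (ler_norm _))// lerDr.
Qed.

Lemma bounded_mgf_le (X : T -> R) (lo hi m s : R) :
  measurable_fun setT X -> lo < hi -> (forall w, lo <= X w <= hi) ->
  (\int[P]_w (X w)%:E = m%:E)%E -> 0 <= s ->
  (\int[P]_w (expR (s * X w))%:E <=
    (expR (s * m + s ^+ 2 * (hi - lo) ^+ 2 / 8))%:E)%E.
Proof.
move=> mX lohi Xb EX s0.
have iX := bounded_integrable mX Xb.
have Em : (m%:E <= hi%:E)%E /\ (lo%:E <= m%:E)%E.
  rewrite -EX -[X in (_ <= X)%E /\ _]mule1 -[X in _ /\ (X <= _)%E]mule1.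
  rewrite -(probability_setT P) -!integral_cst//; split; apply: le_integral => //.
  - exact: finite_measure_integrable_cst.
  - by move=> w _; rewrite lee_fin; case/andP: (Xb w).
  - exact: finite_measure_integrable_cst.
  - by move=> w _; rewrite lee_fin; case/andP: (Xb w).
have lmh : lo <= m <= hi by move: Em => []; rewrite !lee_fin => -> ->.
have := hoeffding_mgf_le lohi lmh s0; rewrite -lee_fin; apply: le_trans.
(* The chord is affine, with intercept [al] and slope [be], so its expectation is its value at the
   mean. *)
pose al := (hi * expR (s * lo) - lo * expR (s * hi)) / (hi - lo).
pose be := (expR (s * hi) - expR (s * lo)) / (hi - lo).
have chordE x : ((hi - x) * expR (s * lo) + (x - lo) * expR (s * hi)) / (hi - lo)
    = al + be * x.
  by rewrite /al /be; field; rewrite subr_eq0 gt_eqF.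
have -> : (((hi - m) * expR (s * lo) + (m - lo) * expR (s * hi)) / (hi - lo))%:E
    = (\int[P]_w (al%:E + be%:E * (X w)%:E))%E.
  rewrite chordE integralD//.
  - rewrite integral_cst// integralZl// EX.
    by rewrite -[RHS]/(al%:E * P setT + be%:E * m%:E)%E probability_setT mule1.
  - exact: finite_measure_integrable_cst.
  - exact: integrableZl.
apply: ge0_le_integral => //.
- apply/measurable_EFinP; apply: measurableT_comp => //.
  exact: measurable_funM.
- apply/measurable_EFinP; apply: measurable_funD => //; exact: measurable_funM.
- move=> w _; rewrite -EFinM -EFinD lee_fin -chordE; exact: expR_chord.
Qed.

Lemma hoeffding_upper (X : nat -> T -> R) (lo hi m : R) N (L : R) :
  (forall l, measurable_fun setT (X l)) -> independent_seq P X -> lo < hi ->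
  (forall l w, lo <= X l w <= hi) -> (forall l, \int[P]_w (X l w)%:E = m%:E)%E ->
  (0 < N)%N -> 0 <= L ->
  (P [set w | (hi - lo) * Num.sqrt (L / (2 * N%:R)) <=
              N%:R^-1 * (\sum_(l < N) X l w) - m]%R <= (expR (- L))%:E)%E.
Proof.
move=> mX indX lohi Xb EX N0 L0.
have w0 : 0 < hi - lo by rewrite subr_gt0.
have NR0 : 0 < N%:R :> R by rewrite ltr0n.
set r := Num.sqrt _; set E := [set w | _].
have r0 : 0 <= r by exact: sqrtr_ge0.
have r2 : r ^+ 2 = L / (2 * N%:R).
  by rewrite sqr_sqrtr// divr_ge0// mulr_ge0// ltW.
(* The minimiser of s^2 (hi - lo)^2 / 8 - s (hi - lo) r; the minimum is - 2 r^2, which over N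
   samples gives - 2 N r^2 = - L. *)
pose s := 4 * r / (hi - lo).
have s0 : 0 <= s by rewrite divr_ge0 ?mulr_ge0// ltW.
pose a := N%:R * (m + (hi - lo) * r).
have mS : measurable_fun setT (fun w => \sum_(l < N) X l w).
  exact: measurable_sum.
have mE : measurable E.
  rewrite -[E]setTI; apply: measurable_fun_le => //.
  by apply: measurable_funB => //; exact: measurable_funM.
rewrite -[E]setIT -integral_indic//.
have mgf := fun l => bounded_mgf_le (mX l) lohi (Xb l) (EX l) s0.
(* Markov's inequality for the exponential of s times the sum, at the level [a] that the sum reaches
   on [E]. *)
apply: (@le_trans _ _ (\int[P]_w
    ((expR (- (s * a)))%:E * (\prod_(l < N) expR (s * X l w))%:E)))%E.
  have mprod : measurable_fun setT (fun w => \prod_(l < N) expR (s * X l w)).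
    apply: measurable_prod => l _; apply: measurableT_comp => //.
    exact: measurable_funM.
  apply: ge0_le_integral => //.
  - exact/measurable_EFinP/measurable_indic.
  - apply/measurable_EFinP; exact: measurable_funM.
  - move=> w _; rewrite -EFinM lee_fin -expR_sum -expRD -mulr_sumr.
    rewrite indicE; case: (boolP (w \in E)) => [|_]; last exact: expR_ge0.
    rewrite inE /E/= lerBrDl ler_pdivlMl// -/a => aS.
    by rewrite -(expR0 R) ler_expR addrC subr_ge0 ler_wpM2l.
rewrite ge0_integralZl//; last 2 first.
- apply/measurable_EFinP; apply: measurable_prod => l _.
  by apply: measurableT_comp => //; exact: measurable_funM.
- by move=> w _; rewrite lee_fin prodr_ge0// => *; exact: expR_ge0.
rewrite (independent_expectation_prod N (g := fun _ x => expR (s * x)) mX indX).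
- apply: (@le_trans _ _ ((expR (- (s * a)))%:E *
     \prod_(l < N) (expR (s * m + s ^+ 2 * (hi - lo) ^+ 2 / 8))%:E)%E).
    apply: lee_wpmul2l; first by rewrite lee_fin expR_ge0.
    suff /andP[] : (0 <= \prod_(l < N) \int[P]_w (expR (s * X l w))%:E <=
        \prod_(l < N) (expR (s * m + s ^+ 2 * (hi - lo) ^+ 2 / 8))%:E)%E by [].
    apply: (big_ind2 (fun x y => 0 <= x <= y)%E); first by rewrite lexx lee01.
      move=> x1 x2 y1 y2 /andP[x10 x12] /andP[y10 y12].
      by rewrite mule_ge0//= lee_pmul.
    move=> l _; rewrite mgf andbT.
    by apply: integral_ge0 => w _; rewrite lee_fin expR_ge0.
  rewrite prodEFin prodr_const card_ord -expRM_natl -EFinM -expRD lee_fin.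
  rewrite ler_expR /a le_eqVlt; apply/orP; left; apply/eqP.
  transitivity (- (2 * N%:R * r ^+ 2)).
    by rewrite /s; field; exact: lt0r_neq0.
  by rewrite r2; field; exact: lt0r_neq0.
- by move=> l; apply: measurableT_comp => //; exact: measurable_funM.
- by move=> l x; exact: expR_ge0.
- by move=> l; rewrite (le_lt_trans (mgf l))// ltry.
Qed.

End hoeffding.

(** * Two-sided bound and union over the sample counts *)

Section concentration.
Context d (T : measurableType d) (R : realType) (P : probability T R).

Lemma independent_seq_comp (X : nat -> T -> R) (f : R -> R) :
  measurable_fun setT f -> independent_seq P X ->
  independent_seq P (fun l w => f (X l w)).
Proof.
move=> mf indX N B mB; apply: (indX N (fun l => f @^-1` B l)) => l.
by rewrite -[_ @^-1` _]setTI; exact: mf.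
Qed.

Lemma hoeffding_two_sided (X : nat -> T -> R) (lo hi m : R) N (L : R) :
  (forall l, measurable_fun setT (X l)) -> independent_seq P X -> lo < hi ->
  (forall l w, lo <= X l w <= hi) -> (forall l, \int[P]_w (X l w)%:E = m%:E)%E ->
  (0 < N)%N -> 0 <= L ->
  measurable [set w | (hi - lo) * Num.sqrt (L / (2 * N%:R)) <=
              `|N%:R^-1 * (\sum_(l < N) X l w) - m| ] /\
  (P [set w | (hi - lo) * Num.sqrt (L / (2 * N%:R)) <=
              `|N%:R^-1 * (\sum_(l < N) X l w) - m| ]%R <= (2 * expR (- L))%:E)%E.
Proof.
move=> mX indX lohi Xb EX N0 L0.
have mS (Y : nat -> T -> R) : (forall l, measurable_fun setT (Y l)) ->
  measurable_fun setT (fun w => N%:R^-1 * (\sum_(l < N) Y l w)).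
  by move=> mY; apply: measurable_funM => //; exact: measurable_sum.
have mXN l : measurable_fun setT (fun w => - X l w).
  exact: measurableT_comp.
set E := [set w | _].
have mE : measurable E.
  rewrite -[E]setTI; apply: measurable_fun_le => //.
  apply: measurableT_comp => //; apply: measurable_funB => //; exact: mS.
split=> //.
have up := hoeffding_upper mX indX lohi Xb EX N0 L0.
have XbN l w : - hi <= - X l w <= - lo by rewrite !lerN2 andbC.
have EXN l : (\int[P]_w (- X l w)%:E = (- m)%:E)%E.
  under eq_integral do rewrite EFinN.
  rewrite integralN ?EX//.
  exact: integrable_add_def (bounded_integrable P (mX l) (Xb l)).
have lohiN : - hi < - lo by rewrite ltrN2.
have dn := hoeffding_upper mXN
  (independent_seq_comp (@oppr_measurable R setT) indX) lohiN XbN EXN N0 L0.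
set U1 := [set w | _] in up; set U2 := [set w | _] in dn.
have mU1 : measurable U1.
  rewrite -[U1]setTI; apply: measurable_fun_le => //.
  apply: measurable_funB => //; exact: mS.
have mU2 : measurable U2.
  rewrite -[U2]setTI; apply: measurable_fun_le => //.
  apply: measurable_funB => //; exact: (mS (fun l w => - X l w)).
apply: (@le_trans _ _ (P (U1 `|` U2))%E).
  apply: le_measure; [by rewrite inE|by rewrite inE; exact: measurableU|].
  move=> w /=; rewrite /E /U1 /U2 /= ler_normr => /orP[h|h].
    by left.
  by right; rewrite sumrN mulrN [- lo - - hi]addrC opprK -opprD.
rewrite mulr_natl mulr2n EFinD; apply: le_trans (leeD up dn).
exact: measureU2.
Qed.

(* Telescoping 1 / t^2 <= 1 / (t - 1/2) - 1 / (t + 1/2). *)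
Lemma sum_inv_sqr_le k :
  \sum_(0 <= i < k) (i.+2%:R ^+ 2)^-1 <= 2 / 3 - (k%:R + 3 / 2)^-1 :> R.
Proof.
elim: k => [|k IH].
  by rewrite big_geq// add0r invf_div subrr.
rewrite big_nat_recr//=; apply: le_trans (lerD IH (lexx _)) _.
have k0 : 0 <= k%:R :> R by [].
rewrite -addrA lerD2l -natr1 -subr_ge0.
rewrite (_ : k.+2%:R = k%:R + 2); last by rewrite -addn2 natrD.
rewrite (_ : _ - _ = (4 * (k%:R + 2) ^+ 2 * (k%:R + 3 / 2) * (k%:R + 5 / 2))^-1).
  by rewrite invr_ge0; nra.
field; lra.
Qed.

(* The radius for N.+1 samples is taken at round N.+2, the earliest round that
   can see them. *)
Definition deviation_event (n : nat) (delta lo hi m : R) (X : nat -> T -> R) : set T :=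
  \bigcup_N [set w |
    (hi - lo) * Num.sqrt (ln (1 / @delta_ R n delta N.+2) / (2 * N.+1%:R)) <=
    `|N.+1%:R^-1 * (\sum_(l < N.+1) X l w) - m| ].

Lemma delta_gt0 n (delta : R) t : 0 < delta -> (0 < t)%N -> 0 < @delta_ R n delta t.
Proof.
move=> d0 t0; rewrite /delta_; apply: divr_gt0; first by rewrite mulr_gt0.
by rewrite !mulr_gt0 ?exprn_gt0 ?pi_gt0 ?ltr0n// addn4.
Qed.

(** The crude bound pi >= 2 is just enough: the factor 2 of the two tails, the 3/4 obtained here and
    the 2/3 that bounds the series have product 1, so a whole family of deviations costs at most
    [delta / (n + 4)]. *)
Lemma delta_le n (delta : R) t : 0 < delta -> (0 < t)%N ->
  @delta_ R n delta t <= delta / (n + 4)%:R * (3 / 4) / t%:R ^+ 2.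
Proof.
move=> d0 t0; rewrite /delta_.
have n4 : 0 < (n + 4)%:R :> R by rewrite ltr0n addn4.
have tR : 0 < t%:R :> R by rewrite ltr0n.
have p2 : 4 <= pi ^+ 2 :> R by have := pi_ge2 R; nra.
rewrite ler_pdivrMr; last by rewrite !mulr_gt0 ?exprn_gt0 ?pi_gt0.
rewrite [leRHS](_ : _ = delta * (3 / 4) * pi ^+ 2); first by nra.
by field; rewrite !gt_eqF.
Qed.

Lemma delta_lt1 n (delta : R) t : 0 < delta < 1 -> (0 < t)%N ->
  @delta_ R n delta t < 1.
Proof.
move=> /andP[d0 d1] t0; apply: le_lt_trans (delta_le n d0 t0) _.
have n4 : 1 <= (n + 4)%:R :> R by rewrite ler1n addn4.
have tR : 1 <= t%:R :> R by rewrite ler1n.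
rewrite ltr_pdivrMr; last by rewrite exprn_gt0 ?ltr0n.
rewrite mulrAC ltr_pdivrMr ?(lt_le_trans ltr01)//; nra.
Qed.

Lemma measurable_deviation_event n (delta lo hi m : R) (X : nat -> T -> R) :
  (forall l, measurable_fun setT (X l)) ->
  measurable (deviation_event n delta lo hi m X).
Proof.
move=> mX; apply: bigcupT_measurable => N.
rewrite -[X in measurable X]setTI; apply: measurable_fun_le => //.
apply: measurableT_comp => //.
apply: measurable_funB => //; apply: measurable_funM => //.
exact: measurable_sum.
Qed.

Lemma deviation_event_le n (delta lo hi m : R) (X : nat -> T -> R) :
  0 < delta < 1 ->
  (forall l, measurable_fun setT (X l)) -> independent_seq P X -> lo < hi ->
  (forall l w, lo <= X l w <= hi) -> (forall l, \int[P]_w (X l w)%:E = m%:E)%E ->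
  (P (deviation_event n delta lo hi m X) <= (delta / (n + 4)%:R)%:E)%E.
Proof.
move=> d01 mX indX lohi Xb EX; have /andP[d0 d1] := d01.
have L0 N : 0 <= ln (1 / @delta_ R n delta N.+2).
  apply: ln_ge0; rewrite ler_pdivlMr ?delta_gt0// mul1r ltW//.
  exact: delta_lt1.
have hoef N := hoeffding_two_sided mX indX lohi Xb EX (ltn0Sn N) (L0 N).
apply: le_trans (measure_sigma_subadditive _ _ _ (@subset_refl _ _)) _.
- by move=> N; case: (hoef N).
- exact: measurable_deviation_event.
apply: lime_le; first by apply: is_cvg_nneseries => N _ _; exact: measure_ge0.
near=> k.
apply: (@le_trans _ _ (\sum_(0 <= N < k)
   (delta / (n + 4)%:R * (3 / 2) * (N.+2%:R ^+ 2)^-1)%:E)%E).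
  apply: lee_sum => N _; apply: le_trans (hoef N).2 _.
  rewrite div1r lnV ?posrE ?delta_gt0// opprK lnK ?posrE ?delta_gt0//.
  rewrite lee_fin; have := delta_le n d0 (ltn0Sn N.+1).
  by move: (@delta_ R n delta N.+2) (delta / _) (_ ^+ 2)^-1 => x A u; lra.
rewrite sumEFin lee_fin -mulr_sumr.
have A0 : 0 < delta / (n + 4)%:R by rewrite divr_gt0// ltr0n addn4.
have := sum_inv_sqr_le k.
have : 0 < (k%:R + 3 / 2)^-1 :> R.
  by rewrite invr_gt0 ltr_wpDl.
nra.
Unshelve. all: by end_near. Qed.

End concentration.

(** * Runs of the algorithm under concentration *)

Lemma sqrt_deviation_le (R : realType) (s' s e U : R) :
  0 <= s' -> 0 <= s -> 0 < e -> `|s' ^+ 2 - s ^+ 2| <= e ->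
  0 < U -> U <= s' ^+ 2 + e -> `|s' - s| <= Num.sqrt 2 * (e / Num.sqrt U).
Proof.
move=> s'0 s0 e0 dev U0 Ule.
have rhs0 : 0 <= Num.sqrt 2 * (e / Num.sqrt U).
  by rewrite mulr_ge0 ?sqrtr_ge0// divr_ge0 ?sqrtr_ge0// ltW.
rewrite -ler_sqr ?nnegrE// exprMn expr_div_n !sqr_sqrtr// ?(ltW U0)//.
rewrite mulrA ler_pdivlMr//.
set D := `|s' - s|; have D0 : 0 <= D by exact: normr_ge0.
have Dle : D * (s' + s) <= e.
  by rewrite /D -[s' + s]ger0_norm ?addr_ge0// -normrM -subr_sqr.
have Ds : D <= s' + s.
  by rewrite /D ler_norml; apply/andP; split; lra.
apply: (@le_trans _ _ (D ^+ 2 * (s' ^+ 2 + e))).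
  by rewrite ler_wpM2l ?sqr_ge0.
(* If s'^2 <= e, then (s' - s)^2 <= |s'^2 - s^2| <= e and U <= 2 e; otherwise
   U <= 2 s'^2 and |s' - s| s' <= e. *)
have [le_e|lt_e] := leP (s' ^+ 2) e.
  have : D ^+ 2 <= e by apply: le_trans Dle; rewrite expr2 ler_wpM2l.
  have := sqr_ge0 D; have := sqr_ge0 s'; nra.
have h1 : D ^+ 2 * s' ^+ 2 <= e ^+ 2.
  rewrite -exprMn ler_sqr ?nnegrE ?mulr_ge0 ?(ltW e0)//.
  by apply: le_trans Dle; rewrite ler_wpM2l// lerDl.
have h2 : D ^+ 2 * e <= D ^+ 2 * s' ^+ 2 by rewrite ler_wpM2l ?sqr_ge0// ltW.
rewrite mulrDr mulr_natl mulr2n; exact: lerD (le_trans h2 h1).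
Qed.

Section ADE_run.
Context {R : realType} {n : nat}.
Variables (a b k delta : R).
Variables (x : nat -> R * R) (y : 'I_n -> nat -> R).
Variable means : 'I_n -> R.

Implicit Types (t m : nat) (st : state n).

Let mu := n%:R^-1 * \sum_(i < n) means i.
Let sig := Num.sqrt (n%:R^-1 * \sum_(i < n) (means i - mu) ^+ 2).
Let theta := mu + k * sig.

Definition radius t m : R :=
  Num.sqrt (ln (1 / @delta_ R n delta t) / (2 * m%:R)).

(** Only the bound for the arms is strict. It makes the test for normal arms imply a mean strictly
    below theta, so that an arm with mean exactly theta, which is an outlier, is never discarded. *)
Record concentrated : Prop := Concentrated {
  arm_concentrated : forall i m,
    `|arm_estimate y i m.+1 - means i| < width a b * radius m.+2 m.+1;
  mu_concentrated : forall m,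
    `|mu_hat x m.+1 - mu| <= width a b * radius m.+2 m.+1;
  mu2_concentrated : forall m,
    `|m.+1%:R^-1 * (\sum_(l < m.+1) (x l).2) - mu|
      <= width a b * radius m.+2 m.+1;
  prod_concentrated : forall m,
    `|m.+1%:R^-1 * (\sum_(l < m.+1) (x l).1 * (x l).2)
       - n%:R^-1 * \sum_(i < n) means i ^+ 2|
      <= width_sq a b * radius m.+2 m.+1;
  sample_bounded : forall l, (a <= (x l).1 <= b) && (a <= (x l).2 <= b);
  means_bounded : forall i, a <= means i <= b
}.

Hypotheses (n_gt0 : (0 < n)%N) (a_ge0 : 0 <= a) (ab : a < b) (k_ge0 : 0 <= k).
Hypothesis delta01 : 0 < delta < 1.
Hypothesis good : concentrated.

Let C := width_sq a b + 2 * b * width a b.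

Let w_gt0 : 0 < width a b.
Proof. by rewrite subr_gt0. Qed.

Let ws_gt0 : 0 < width_sq a b.
Proof.
rewrite /width_sq subr_sqr mulr_gt0 ?subr_gt0//.
by rewrite ltr_pwDl// (le_lt_trans a_ge0).
Qed.

Let C_gt0 : 0 < C.
Proof.
by rewrite addr_gt0// !mulr_gt0// (le_lt_trans a_ge0).
Qed.

Let log t := ln (1 / @delta_ R n delta t).

Lemma log_gt0 t : (0 < t)%N -> 0 < log t.
Proof.
move=> t0; have /andP[d0 d1] := delta01.
by rewrite /log ln_gt0// ltr_pdivlMr ?delta_gt0// mul1r delta_lt1.
Qed.

Lemma log_le t t' : (0 < t)%N -> (t <= t')%N -> log t <= log t'.
Proof.
move=> t0 tt'; have /andP[d0 d1] := delta01.
have t'0 := leq_trans t0 tt'.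
have den0 s : (0 < s)%N -> 0 < (n + 4)%:R * pi ^+ 2 * s%:R ^+ 2 :> R.
  by move=> s0; rewrite !mulr_gt0 ?exprn_gt0 ?pi_gt0 ?ltr0n// addn4.
rewrite /log !div1r ler_ln ?posrE ?invr_gt0 ?delta_gt0//.
rewrite lef_pV2 ?posrE ?delta_gt0// /delta_.
rewrite ler_pM2l; last by rewrite mulr_gt0.
rewrite lef_pV2 ?posrE ?den0// ler_pM2l ?ler_sqr ?nnegrE ?ler_nat//.
by rewrite !mulr_gt0 ?exprn_gt0 ?pi_gt0 ?ltr0n// addn4.
Qed.

Lemma radius_gt0 t m : (0 < t)%N -> (0 < m)%N -> 0 < radius t m.
Proof.
move=> t0 m0; rewrite sqrtr_gt0 divr_gt0 ?log_gt0// mulr_gt0// ltr0n//.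
Qed.

Lemma radius_sqr t m : (0 < t)%N -> (0 < m)%N ->
  radius t m ^+ 2 = log t / (2 * m%:R).
Proof.
by move=> t0 m0; rewrite sqr_sqrtr// divr_ge0// ltW// log_gt0.
Qed.

Lemma radius_le t t' m m' : (0 < t)%N -> (t <= t')%N -> (0 < m')%N ->
  (m' <= m)%N -> radius t m <= radius t' m'.
Proof.
move=> t0 tt' m0 mm'; apply: ler_wsqrtr; apply: ler_pM.
- exact/ltW/log_gt0.
- by rewrite invr_ge0 mulr_ge0.
- exact: log_le.
- have m_gt0 := leq_trans m0 mm'.
  by rewrite lef_pV2 ?posrE ?ler_pM2l ?ler_nat ?mulr_gt0 ?ltr0n.
Qed.

(** * Accuracy of the estimators *)

Lemma arm_estimate_close i t m : (0 < m)%N -> (m < t)%N ->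
  `|arm_estimate y i m - means i| < width a b * radius t m.
Proof.
case: m => // m _ mt; apply: lt_le_trans (arm_concentrated good i m) _.
by rewrite ler_pM2l// radius_le.
Qed.

Lemma mu_hat_close t m : (0 < m)%N -> (m < t)%N ->
  `|mu_hat x m - mu| <= width a b * radius t m.
Proof.
case: m => // m _ mt; apply: le_trans (mu_concentrated good m) _.
by rewrite ler_pM2l// radius_le.
Qed.

Lemma average_bounded (I : finType) (f : I -> R) :
  (0 < #|I|)%N -> (forall i, a <= f i <= b) ->
  a <= #|I|%:R^-1 * (\sum_i f i) <= b.
Proof.
move=> I0 fb; have I0R : 0 < #|I|%:R :> R by rewrite ltr0n.
rewrite ler_pdivlMl// ler_pdivrMl//.
rewrite !(mulr_natl _ #|I|) -!sumr_const; apply/andP; split.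
  by apply: ler_sum => i _; case/andP: (fb i).
by apply: ler_sum => i _; case/andP: (fb i).
Qed.

Lemma mu_bounded : a <= mu <= b.
Proof.
have := @average_bounded 'I_n means; rewrite card_ord; apply=> // i.
exact: means_bounded.
Qed.

Lemma sig_sqr : sig ^+ 2 = n%:R^-1 * \sum_(i < n) means i ^+ 2 - mu ^+ 2.
Proof.
have nR : n%:R != 0 :> R by rewrite pnatr_eq0 -lt0n.
rewrite sqr_sqrtr; last first.
  by rewrite mulr_ge0// sumr_ge0// => i _; exact: sqr_ge0.
under eq_bigr do rewrite sqrrB.
rewrite big_split sumrB/= sumr_const card_ord sumrMnl -mulr_suml.
rewrite -[\sum_(i < n) means i](mulVKf nR) -/mu.
by rewrite -[_ *+ n]mulr_natl -mulr_natl; field.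
Qed.

(** The variance estimate is the average product minus the product of the two averages. The average
    product deviates by [width_sq] times the radius. Replacing the two averages by [mu] one after
    the other costs [width] times the radius each, multiplied by a factor in [0, b]. This is the
    origin of [width_sq + 2 * b * width]. *)
Lemma sigma_hat_close t m : (0 < m)%N -> (m < t)%N ->
  `|sigma_hat x m ^+ 2 - sig ^+ 2| <= C * radius t m.
Proof.
case: m => // m _ mt.
have rle c : 0 < c -> c * radius m.+2 m.+1 <= c * radius t m.+1.
  by move=> c0; rewrite ler_pM2l// radius_le.
have h1 := le_trans (mu_concentrated good m) (rle _ w_gt0).
have h2 := le_trans (mu2_concentrated good m) (rle _ w_gt0).
have h3 := le_trans (prod_concentrated good m) (rle _ ws_gt0).
rewrite sqr_sqrtr//.
have sum2 : (m.+1%:R ^+ 2)^-1 * (\sum_(l < m.+1) \sum_(h < m.+1) (x l).1 * (x h).2)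
   = mu_hat x m.+1 * (m.+1%:R^-1 * \sum_(l < m.+1) (x l).2) :> R.
  under eq_bigr do rewrite -mulr_sumr.
  by rewrite -mulr_suml /mu_hat expr2 invfM; ring.
rewrite sum2; clear sum2.
have x2b : a <= m.+1%:R^-1 * (\sum_(l < m.+1) (x l).2) <= b.
  have := @average_bounded 'I_m.+1 (fun l => (x l).2); rewrite card_ord.
  by apply=> // l; case/andP: (sample_bounded good l).
move: h1 h2 h3 x2b mu_bounded; rewrite -/C.
set p := _ * \sum_(l < m.+1) _ * _; set x2 := _ * \sum_(l < m.+1) _.
set x1 := mu_hat _ _ => h1 h2 h3 /andP[x2a x2b] /andP[mua mub].
set q := _ * \sum_(i < n) _ in h3.
have sq : sig ^+ 2 = q - mu ^+ 2 by exact: sig_sqr.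
(* As sig^2 is its own absolute value, the absolute value inside [sigma_hat] cannot increase the
   distance. *)
apply: (@le_trans _ _ `|p - x1 * x2 - sig ^+ 2|).
  rewrite -{1}(ger0_norm (sqr_ge0 sig)).
  exact: ler_dist_dist.
rewrite sq.
have -> : p - x1 * x2 - (q - mu ^+ 2) = (p - q) - ((x1 - mu) * x2 + mu * (x2 - mu)).
  by ring.
rewrite (le_trans (ler_normB _ _))// /C [leRHS]mulrDl lerD//.
have x20 : 0 <= x2 by exact: le_trans x2a.
have mu0 : 0 <= mu by exact: le_trans mua.
have h4 : `|(x1 - mu) * x2| <= width a b * radius t m.+1 * b.
  by rewrite normrM ler_pM// ger0_norm.
have h5 : `|mu * (x2 - mu)| <= b * (width a b * radius t m.+1).
  by rewrite normrM ler_pM// ger0_norm.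
apply: le_trans (ler_normD _ _) (le_trans (lerD h4 h5) _).
by rewrite le_eqVlt; apply/orP; left; apply/eqP; ring.
Qed.

(** * Sample counts and radii along a run *)

Let width_theta st : R := width a b + Num.sqrt 2 * k *
  (C / Num.sqrt (fine (U_sigma a b delta x st))).

Let now st := mtheta_now st.

(** Every round takes exactly one sample and round 1 starts with none, hence [round_counts]. Counts
    of earlier rounds are tracked because [U_sigma] is a minimum over all of them. The pull count of
    an arm follows [mseq] only while the arm is a candidate. *)
Record sample_counts st : Prop := SampleCounts {
  counts_before : forall tau, (0 < tau <= round st)%N ->
    (mtheta_at st tau < tau)%N /\ (mtheta_at st tau <= now st)%N;
  now_gt0 : (0 < now st)%N;
  mseq_gt0 : (0 < mseq st)%N;
  round_counts : round st = (now st + mseq st).+1;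
  marm_counts : forall i, i \in cand st -> marm st i = mseq st
}.

(** Common to both kinds of sample: the hypotheses force exactly one of the two counts to grow, by
    one. *)
Lemma sample_countsS st st' (m : nat) : sample_counts st ->
  mtheta st' = rcons (mtheta st) m -> (now st <= m <= (now st).+1)%N ->
  (mseq st <= mseq st')%N -> (m + mseq st' = (now st + mseq st).+1)%N ->
  (forall i, i \in cand st' -> marm st' i = mseq st') ->
  sample_counts st'.
Proof.
case=> before now0 mseq0 rd mcand Emth /andP[le_m m_le] le_mseq msum mcand'.
have rd' : round st' = (round st).+1 by rewrite /round Emth size_rcons.
have now' : now st' = m.
  by rewrite /now /mtheta_now /mtheta_at rd' Emth /= nth_rcons ltnn eqxx.
split; rewrite ?now' ?rd' ?rd ?msum//.
- move=> tau /andP[tau0]; rewrite leq_eqVlt => /orP[/eqP->|tau_le].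
    have -> : mtheta_at st' (now st + mseq st).+2 = m.
      by rewrite -[RHS]now' -rd -rd'.
    by split=> //; rewrite ltnS (leq_trans m_le)// ltnS leq_addr.
  have tau_in : (tau.-1 < size (mtheta st))%N.
    by rewrite -/(round st) rd; case: tau tau0 tau_le.
  rewrite /mtheta_at Emth nth_rcons tau_in -/(mtheta_at st tau).
  have [|h1 h2] := before tau; first by rewrite tau0 rd.
  by split=> //; exact: leq_trans le_m.
- exact: leq_trans le_m.
- exact: leq_trans le_mseq.
Qed.

Lemma sample_counts_random st : sample_counts st -> sample_counts (random_sample st).
Proof.
move=> cst; have [_ _ _ _ mcand] := cst.
apply: (sample_countsS cst (m := (now st).+1)) => //.
by rewrite leqnSn leqnn.
Qed.

Lemma sample_counts_sequential st :
  sample_counts st -> sample_counts (sequential_sample st).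
Proof.
move=> cst; have [_ _ _ _ mcand] := cst.
apply: (sample_countsS cst (m := now st)) => //=.
- by rewrite leqnn leqnSn.
- by rewrite addnS.
- by move=> i ic; rewrite ffunE ic addn1 mcand.
Qed.

Lemma sample_counts_initial : sample_counts initial.
Proof.
split=> //=.
  (* The initial history of random counts is 0, 1, 1, so the loop starts in round 3. *)
  by move=> [|[|[|[|tau]]]].
by move=> i _; rewrite !ffunE inE.
Qed.

(** The upper bound is the term of the current round. For the lower bound, each term with a nonzero
    count has a radius taken at round 1 or later with at most [now st] samples, and the other terms
    are infinite. So the minimum is a positive real and [fine] loses nothing. *)
Lemma U_sigma_bounds st : sample_counts st ->
  exists2 u, U_sigma a b delta x st = u%:E &
    [/\ 0 < u, u <= sigma_hat x (now st) ^+ 2 + C * radius (round st) (now st)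
      & C * radius 1 (now st) <= u].
Proof.
case=> before now0 mseq0 rd mcand.
have le_U : (U_sigma a b delta x st <=
    (sigma_hat x (now st) ^+ 2 + C * radius (round st) (now st))%:E)%E.
  rewrite /U_sigma.
  rewrite big_nat_recr/=; last by rewrite rd.
  rewrite ge_min; apply/orP; right.
  rewrite /eps_sigma /conf_radius -/(mtheta_now st) -/(now st).
  by rewrite gtn_eqF// -EFinD.
have ge_U : ((C * radius 1 (now st))%:E <= U_sigma a b delta x st)%E.
  rewrite /U_sigma big_nat; elim/big_rec: _ => [|tau u /andP[tau0 tau_le] le_u].
    by rewrite leey.
  rewrite le_min le_u andbT; have [|lt_tau le_now] := before tau.
    by rewrite tau0.
  rewrite /eps_sigma /conf_radius; case: eqP => [_|/eqP]; first by rewrite addey ?leey.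
  rewrite -lt0n => m0; rewrite -EFinD lee_fin.
  apply: (@le_trans _ _ (C * radius tau (mtheta_at st tau))).
    by rewrite ler_pM2l// radius_le.
  by rewrite lerDr sqr_ge0.
move: le_U ge_U; case: (U_sigma a b delta x st) => [u||]//; rewrite !lee_fin => h1 h2.
exists u => //; split => //; apply: lt_le_trans h2.
by rewrite mulr_gt0// radius_gt0.
Qed.

Lemma r_thetaE st : sample_counts st ->
  r_theta a b k delta x st = (width_theta st * radius (round st) (now st))%:E.
Proof. by case=> _ now0 _ _ _; rewrite /r_theta /conf_radius gtn_eqF. Qed.

Lemma r_seqE st : sample_counts st ->
  r_seq a b delta st = (width a b * radius (round st) (mseq st))%:E.
Proof. by case=> _ _ mseq0 _ _; rewrite /r_seq /conf_radius gtn_eqF. Qed.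

Lemma r_armE st i : sample_counts st -> i \in cand st ->
  r_arm a b delta st i = (width a b * radius (round st) (mseq st))%:E.
Proof.
by case=> _ _ mseq0 _ mcand ic; rewrite /r_arm mcand// /conf_radius gtn_eqF.
Qed.

Lemma theta_hat_close st : sample_counts st ->
  `|theta_hat k x (now st) - theta| <= width_theta st * radius (round st) (now st).
Proof.
move=> cst; have [u Uu [u0 le_u _]] := U_sigma_bounds cst.
have [_ now0 _ rd _] := cst.
have lt_now : (now st < round st)%N by rewrite rd ltnS leq_addr.
have r0 : 0 < radius (round st) (now st).
  by rewrite radius_gt0 ?(leq_ltn_trans (leq0n _) lt_now).
have sdev : `|sigma_hat x (now st) - sig| <=
    Num.sqrt 2 * ((C * radius (round st) (now st)) / Num.sqrt u).
  apply: sqrt_deviation_le => //; rewrite ?sqrtr_ge0//.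
  - by rewrite mulr_gt0.
  - exact: sigma_hat_close.
rewrite /theta_hat /theta /width_theta Uu/=.
have -> : mu_hat x (now st) + k * sigma_hat x (now st) - (mu + k * sig) =
   (mu_hat x (now st) - mu) + k * (sigma_hat x (now st) - sig) by ring.
apply: le_trans (ler_normD _ _) _; rewrite mulrDl lerD ?mu_hat_close//.
rewrite normrM (ger0_norm k_ge0).
apply: le_trans (ler_wpM2l k_ge0 sdev) _.
by rewrite le_eqVlt; apply/orP; left; apply/eqP; ring.
Qed.

Lemma candidate_close st i : sample_counts st -> i \in cand st ->
  `|arm_estimate y i (marm st i) - means i| <
    width a b * radius (round st) (mseq st).
Proof.
case=> _ _ mseq0 rd mcand ic; rewrite mcand//.
by apply: arm_estimate_close => //; rewrite rd ltnS leq_addl.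
Qed.

(** * Correctness and completeness of the two tests *)

Lemma is_normal_sound st i : sample_counts st -> i \in cand st ->
  is_normal a b k delta x y st i -> means i < theta.
Proof.
move=> cst ic; rewrite /is_normal r_armE// r_thetaE// -!EFinD lee_fin.
have := candidate_close cst ic; have := theta_hat_close cst.
rewrite ler_norml ltr_norml -/(now st) => /andP[h1 h2] /andP[h3 h4] h5.
by move: h1 h2 h3 h4 h5; rewrite /now /=; lra.
Qed.

Lemma is_outlier_sound st i : sample_counts st -> i \in cand st ->
  is_outlier a b k delta x y st i -> theta <= means i.
Proof.
move=> cst ic; rewrite /is_outlier => /andP[_].
rewrite r_armE// r_thetaE// -!EFinD lee_fin.
have := candidate_close cst ic; have := theta_hat_close cst.
rewrite ler_norml ltr_norml => /andP[h1 h2] /andP[h3 h4] h5.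
by move: h1 h2 h3 h4 h5; rewrite /now /=; lra.
Qed.

(** Each estimate may be off by its radius, and the test asks for the sum of both radii once more
    between the estimates; hence the factors 2. *)
Lemma classified st i : sample_counts st -> i \in cand st ->
  2 * (width a b * radius (round st) (mseq st)) +
    2 * (width_theta st * radius (round st) (now st)) <= `|theta - means i| ->
  is_normal a b k delta x y st i || is_outlier a b k delta x y st i.
Proof.
move=> cst ic sep; rewrite /is_outlier.
case: (boolP (is_normal _ _ _ _ _ _ _ _)) => //=.
rewrite /is_normal r_armE// r_thetaE// -!EFinD !lee_fin.
have := candidate_close cst ic; have := theta_hat_close cst.
rewrite ler_norml ltr_norml => /andP[h1 h2] /andP[h3 h4].
rewrite -ltNge => h5; move: h1 h2 h3 h4 h5 sep; rewrite /now /=.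
by case: (leP 0 (theta - means i)) => [/ger0_norm|/ltr0_norm] ->; lra.
Qed.

(* U >= C * radius 1 m bounds the squared coefficient of the radius of theta
   after m random samples by growth * sqrt m. *)
Let growth := 2 * width a b ^+ 2 + 4 * k ^+ 2 * C * Num.sqrt (2 / log 1).

Let growth_gt0 : 0 < growth.
Proof.
apply: ltr_pwDl; first by rewrite mulr_gt0// exprn_gt0.
by rewrite !mulr_ge0 ?sqr_ge0 ?sqrtr_ge0 ?(ltW C_gt0).
Qed.

Lemma width_theta_gt0 st : 0 < width_theta st.
Proof.
rewrite ltr_pwDl// mulr_ge0 ?divr_ge0 ?sqrtr_ge0 ?(ltW C_gt0)//.
by rewrite mulr_ge0 ?sqrtr_ge0.
Qed.

Lemma width_theta_sqr_le st : sample_counts st ->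
  width_theta st ^+ 2 <= growth * Num.sqrt (now st)%:R.
Proof.
move=> cst; have [u Uu [u0 _ le_u]] := U_sigma_bounds cst.
have [_ now0 _ _ _] := cst.
have nowR : 1 <= (now st)%:R :> R by rewrite ler1n.
have sqrt_now : 1 <= Num.sqrt (now st)%:R :> R by rewrite -[leLHS]sqrtr1 ler_wsqrtr.
have l1 : 0 < log 1 by exact: log_gt0.
(* The inverse of [radius 1 m] is the square root of 2 m / log 1, which accounts for the constant in
   [growth]. *)
have CU : C / u <= Num.sqrt (2 / log 1) * Num.sqrt (now st)%:R.
  rewrite ler_pdivrMr// -sqrtrM ?divr_ge0// ?(ltW l1)//.
  have r1 : 0 < radius 1 (now st) by exact: radius_gt0.
  apply: (@le_trans _ _ (Num.sqrt (2 / log 1 * (now st)%:R) * (C * radius 1 (now st)))).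
    rewrite mulrCA /radius -sqrtrM; last first.
      by rewrite mulr_ge0// divr_ge0// ltW.
    rewrite -/(log 1) (_ : 2 / log 1 * _ * _ = 1) ?sqrtr1 ?mulr1//.
    by field; rewrite !gt_eqF// (lt_le_trans _ nowR).
  by rewrite ler_wpM2l ?sqrtr_ge0.
have wt2 : width_theta st ^+ 2 <= 2 * width a b ^+ 2 + 4 * k ^+ 2 * (C * (C / u)).
  have -> : 4 * k ^+ 2 * (C * (C / u)) = 2 * (Num.sqrt 2 * k * (C / Num.sqrt u)) ^+ 2.
    rewrite !exprMn exprVn !sqr_sqrtr ?(ltW u0)//; ring.
  rewrite /width_theta Uu/=; move: (Num.sqrt 2 * k * (C / Num.sqrt u)) => v.
  rewrite -subr_ge0 (_ : _ - _ = (width a b - v) ^+ 2) ?sqr_ge0//; ring.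
(* The term without U is multiplied by the square root of the count, which is at least 1, to give
   both terms the same form. *)
apply: le_trans wt2 _; rewrite /growth [leRHS]mulrDl; apply: lerD.
  by rewrite ler_peMr// mulr_ge0// sqr_ge0.
have k2 : 0 <= 4 * k ^+ 2 by rewrite mulr_ge0 ?sqr_ge0.
have := ler_wpM2l k2 (ler_wpM2l (ltW C_gt0) CU).
by rewrite !mulrA.
Qed.

(** * Termination: comparing the two sample counts *)

Let balance := (growth / width a b ^+ 2) ^+ 2.

(** A sequential sample is taken only when its radius is the larger one; as [width] is at most
    [width_theta], this forces [mseq < now]. A random sample is taken only when width^2 now <=
    width_theta^2 mseq, and the bound by [growth] turns this into sqrt(now) <= (growth / width^2)
    mseq. That inequality concerns the count before the sample, hence the predecessor. *)
Record balanced st : Prop := Balanced {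
  mseq_le_now : (mseq st <= now st)%N;
  now_le_mseq : ((now st).-1)%:R <= balance * (mseq st)%:R ^+ 2
}.

Let balance_ge0 : 0 <= balance.
Proof. exact: sqr_ge0. Qed.

Lemma now_random st : now (random_sample st) = (now st).+1.
Proof.
by rewrite /now /mtheta_now /mtheta_at /round /= size_rcons nth_rcons ltnn eqxx.
Qed.

Lemma now_sequential st : now (sequential_sample st) = now st.
Proof.
by rewrite /now /mtheta_now /mtheta_at /round /= size_rcons nth_rcons ltnn eqxx.
Qed.

Lemma balanced_random st : sample_counts st -> balanced st ->
  (r_seq a b delta st <= r_theta a b k delta x st)%E -> balanced (random_sample st).
Proof.
move=> cst [le_now _]; rewrite r_seqE// r_thetaE// lee_fin => le_r.
have [_ now0 mseq0 rd _] := cst.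
have rd0 : (0 < round st)%N by rewrite rd.
have nowR : 0 < (now st)%:R :> R by rewrite ltr0n.
have mseqR : 0 < (mseq st)%:R :> R by rewrite ltr0n.
split; rewrite now_random; first exact: leqW.
have := le_r; rewrite -ler_sqr ?nnegrE ?mulr_ge0 ?sqrtr_ge0 ?(ltW w_gt0)
  ?(ltW (width_theta_gt0 st))//.
rewrite !exprMn !radius_sqr// => le_r2.
have L0 : 0 < log (round st) by exact: log_gt0.
have {le_r2} le2 : width a b ^+ 2 * (now st)%:R <= width_theta st ^+ 2 * (mseq st)%:R.
  have c_gt0 : 0 < log (round st) / (2 * (mseq st)%:R * (now st)%:R).
    by rewrite divr_gt0// !mulr_gt0.
  rewrite -(ler_pM2l c_gt0).
  apply: le_trans (le_trans _ le_r2) _; rewrite le_eqVlt; apply/orP; left; apply/eqP;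
    by field; rewrite !gt_eqF.
have {le2} le3 := le_trans le2 (ler_wpM2r (ltW mseqR) (width_theta_sqr_le cst)).
set s := Num.sqrt (now st)%:R in le3.
have s0 : 0 < s by rewrite sqrtr_gt0.
have s2 : (now st)%:R = s ^+ 2 by rewrite sqr_sqrtr// ltW.
have le4 : s <= growth / width a b ^+ 2 * (mseq st)%:R.
  rewrite mulrAC ler_pdivlMr ?exprn_gt0// -(ler_pM2r s0).
  by move: le3; rewrite s2; lra.
rewrite /= s2 /balance -exprMn ler_sqr ?nnegrE ?(ltW s0)//.
by apply: le_trans le4; exact: ltW.
Qed.

Lemma balanced_sequential st : sample_counts st -> balanced st ->
  ~~ (r_seq a b delta st <= r_theta a b k delta x st)%E ->
  balanced (sequential_sample st).
Proof.
move=> cst [le_now le_mseq]; rewrite r_seqE// r_thetaE// lee_fin -ltNge => lt_r.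
have [_ now0 mseq0 rd _] := cst.
have rd0 : (0 < round st)%N by rewrite rd.
split; rewrite now_sequential/=.
  have : ~~ (now st <= mseq st)%N; last by rewrite -ltnNge.
  apply/negP => le_mseq'; move: lt_r; apply/negP; rewrite -leNgt.
  apply: ler_pM; rewrite ?sqrtr_ge0 ?(ltW w_gt0)//.
    rewrite /width_theta lerDl mulr_ge0 ?divr_ge0 ?sqrtr_ge0 ?(ltW C_gt0)//.
    by rewrite mulr_ge0 ?sqrtr_ge0.
  exact: radius_le.
apply: le_trans le_mseq _; rewrite ler_wpM2l// ler_sqr ?nnegrE//.
by rewrite ler_nat.
Qed.

Lemma balanced_initial : balanced initial.
Proof. by split=> //=; rewrite mulr_ge0 ?sqr_ge0. Qed.

(** The state between the two halves of a loop pass: the choice of the sample reads the old state,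
    the classification reads this one and changes no count. *)
Definition sampled st : state n :=
  if (r_seq a b delta st <= r_theta a b k delta x st)%E
  then random_sample st else sequential_sample st.

(** The third clause ensures that an arm just declared normal is not already listed as an outlier,
    which the fourth needs when the arm leaves the candidates. *)
Definition invariant st : Prop :=
  [/\ sample_counts st, balanced st,
      forall i, i \in cand st -> i \notin outlier_set st &
      forall i, i \notin cand st -> (i \in outlier_set st) = (theta <= means i)].

Lemma invariant_sampled st : invariant st -> invariant (sampled st).
Proof.
case=> cst bst h1 h2; rewrite /sampled; case: ifPn => le_r.
  by split=> //; [exact: sample_counts_random | exact: balanced_random].
by split=> //; [exact: sample_counts_sequential | exact: balanced_sequential].
Qed.

Lemma invariant_loop_body st : invariant st ->
  invariant (loop_body a b k delta x y st).
Proof.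
move=> /invariant_sampled; rewrite /loop_body -/(sampled st).
move: (sampled st) => {}st [cst bst h1 h2].
have [before now0 mseq0 rd mcand] := cst.
split.
- by split=> // i; rewrite inE => /andP[ic _]; exact: mcand.
- by case: bst => le_now le_mseq; split.
- move=> i; rewrite !inE => /andP[ic /andP[_ /negbTE ->]].
  by rewrite andbF orbF; exact: h1.
- move=> i; rewrite !inE negb_and -!negb_or negbK.
  have [ic|inc] := boolP (i \in cand st); last by move=> _; rewrite orbF h2.
  rewrite (negbTE (h1 i ic))/= => /orP[inorm|iout].
    rewrite /is_outlier inorm/=.
    by apply/esym/negbTE; rewrite -ltNge; exact: is_normal_sound inorm.
  by rewrite iout; apply/esym; exact: is_outlier_sound iout.
Qed.

Lemma invariant_ADE_state j : invariant (ADE_state a b k delta x y j).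
Proof.
elim: j => [|j IH]; last first.
  by rewrite /ADE_state iterS; case: ifP => // _; exact: invariant_loop_body.
split.
- exact: sample_counts_initial.
- exact: balanced_initial.
- by move=> i _; rewrite finset.in_set0.
- by move=> i; rewrite finset.in_setT.
Qed.

Lemma ADE_returns_correct O : ADE_returns a b k delta x y O ->
  O = [set i | theta <= means i]%SET.
Proof.
move=> [j [cand0 <-]]; have [_ _ _ out] := invariant_ADE_state j.
by apply/setP => i; rewrite inE out// cand0 inE.
Qed.

Lemma round_ADE_state j : cand (ADE_state a b k delta x y j) != finset.set0 ->
  round (ADE_state a b k delta x y j) = j.+3.
Proof.
elim: j => [//|j IH]; rewrite /ADE_state iterS -/(ADE_state _ _ _ _ _ _ _).
case: ifPn => [/eqP ->|cn0 _]; first by rewrite eqxx.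
rewrite /loop_body /round/=; case: ifP => _ /=; rewrite size_rcons; congr _.+1; exact: IH.
Qed.

(** One round with small radii decides all remaining candidates, so a single convenient t is enough:
    for a fourth power the left side is of order s^2 against s^4. *)
Lemma log_sqr_small (eta : R) : 0 < eta ->
  exists2 t, (4 <= t)%N & log t ^+ 2 <= eta * (t%:R - 3).
Proof.
move=> eta0; have /andP[d0 d1] := delta01.
pose A := (n + 4)%:R * pi ^+ 2 / (3 * delta) : R.
have A0 : 0 < A.
  by rewrite !mulr_gt0 ?invr_gt0 ?mulr_gt0 ?exprn_gt0 ?pi_gt0// ltr0n addn4.
(* The square of t = s^4 inside [delta_] gives log t = ln A + 8 ln s, and ln s <= s, so [B * s]
   bounds it. *)
pose B := `|ln A| + 8; have B0 : 0 < B by rewrite ltr_wpDl.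
(* On the rounds t = s ^ 4, log t is at most linear in s. *)
pose s := (Num.truncn (2 * B ^+ 2 / eta)).+2.
have s_ge : 2 * B ^+ 2 / eta <= s%:R.
  by rewrite ltW// (lt_trans (truncnS_gt _))// ltr_nat.
have s2 : 2 <= s%:R :> R by rewrite ler_nat.
have s0 : 0 < s%:R :> R by rewrite ltr0n.
have lns : ln s%:R <= s%:R :> R by rewrite ltW// ln_sublinear.
exists (s ^ 4)%N.
  rewrite /s; move: (Num.truncn _) => z.
  by rewrite (@leq_trans (2 ^ 4)%N)// leq_exp2r.
have logE : log (s ^ 4) = ln A + 8 * ln s%:R.
  rewrite /log /delta_ natrX.
  have -> : 1 / (3 * delta / ((n + 4)%:R * pi ^+ 2 * (s%:R ^+ 4) ^+ 2)) = A * s%:R ^+ 8.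
    have n4 : (n + 4)%:R != 0 :> R by rewrite addn4.
    have pi0 : pi != 0 :> R by rewrite gt_eqF// pi_gt0.
    have delta0 : delta != 0 by rewrite gt_eqF.
    have sn0 : s%:R != 0 :> R by rewrite gt_eqF.
    rewrite /A; move: ((n + 4)%:R) pi (s%:R : R) n4 pi0 sn0 => N p z N0 p0 z0.
    by field; rewrite N0 p0 z0 delta0.
  by rewrite lnM ?posrE ?exprn_gt0// lnXn// mulr_natl.
have log_le_B : log (s ^ 4) <= B * s%:R.
  rewrite logE /B [leRHS]mulrDl; apply: lerD; last by rewrite ler_pM2l.
  rewrite (le_trans (ler_norm _))// ler_peMr//; lra.
have log0 : 0 <= log (s ^ 4) by rewrite ltW// log_gt0// expn_gt0.
apply: (@le_trans _ _ ((B * s%:R) ^+ 2)).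
  by rewrite ler_sqr ?nnegrE// mulr_ge0// ltW.
have le1 : 2 * B ^+ 2 <= eta * s%:R by rewrite [leRHS]mulrC -ler_pdivrMr.
rewrite natrX exprMn; move: le1 s2; move: (B ^+ 2) (s%:R) => B2 z le1 z2.
(* For z >= 2, z^4 - 3 >= 2 z^3 - 3, and z^3 >= 8 leaves ample room. *)
have z4 : z ^+ 2 * z / 2 <= z ^+ 4 - 3.
  have : 0 <= (z - 2) * z ^+ 3 by rewrite mulr_ge0 ?exprn_ge0; lra.
  have : 8 <= z ^+ 3.
    by rewrite (_ : 8 = 2 ^+ 3); [rewrite lerXn2r ?nnegrE//; lra|ring].
  rewrite (_ : z ^+ 2 * z = z ^+ 3); last by ring.
  rewrite (_ : (z - 2) * z ^+ 3 = z ^+ 4 - 2 * z ^+ 3); last by ring.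
  lra.
apply: le_trans (ler_wpM2l (ltW eta0) z4).
have : B2 * z ^+ 2 * 2 <= eta * z * z ^+ 2.
  by rewrite mulrAC ler_wpM2r ?sqr_ge0// mulrC.
by move=> h; rewrite -(ler_pM2r (_ : 0 < 2)) ?ltr0n//; apply: le_trans h _;
  rewrite le_eqVlt; apply/orP; left; apply/eqP; field.
Qed.

Lemma eventually_classified (eps : R) : 0 < eps ->
  exists2 t, (4 <= t)%N & forall st, sample_counts st -> balanced st ->
    round st = t -> width a b * radius (round st) (mseq st) <= eps /\
      width_theta st * radius (round st) (now st) <= eps.
Proof.
move=> eps0.
(* Both constants are found backwards: each radius bound is an upper bound on log t, linear in mseq
   for the arms and in sqrt(now) for theta; it is squared, and the count is bounded below through t
   - 3. *)
pose eta1 := (2 * eps ^+ 2 / width a b ^+ 2) ^+ 2 / (2 * (balance + 1)).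
pose eta2 := (2 * eps ^+ 2 / growth) ^+ 2 / 2.
have b10 : 0 < balance + 1 by rewrite ltr_wpDl.
have eta10 : 0 < eta1.
  by rewrite !mulr_gt0 ?exprn_gt0 ?invr_gt0 ?mulr_gt0 ?invr_gt0 ?exprn_gt0.
have eta20 : 0 < eta2.
  by rewrite !mulr_gt0 ?exprn_gt0 ?invr_gt0 ?mulr_gt0 ?invr_gt0 ?exprn_gt0.
have eta12 : 0 < Num.min eta1 eta2 by rewrite lt_min eta10 eta20.
have [t t4 logt] := log_sqr_small eta12; exists t => // st cst bst rdt.
have [_ now0 mseq0 rd _] := cst; have [le_now le_mseq] := bst.
have t3 : 0 <= t%:R - 3 :> R by rewrite subr_ge0 ler_nat ltnW.
have log1 : log t ^+ 2 <= eta1 * (t%:R - 3).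
  by rewrite (le_trans logt)// ler_wpM2r// ge_min lexx.
have log2 : log t ^+ 2 <= eta2 * (t%:R - 3).
  by rewrite (le_trans logt)// ler_wpM2r// ge_min lexx orbT.
have t0 : (0 < t)%N by exact: leq_trans t4.
have L0 : 0 < log t by exact: log_gt0.
have nowR : 0 < (now st)%:R :> R by rewrite ltr0n.
have mseqR : 0 < (mseq st)%:R :> R by rewrite ltr0n.
have tE : t%:R = (now st)%:R + (mseq st)%:R + 1 :> R.
  by rewrite -rdt rd -natr1 natrD.
have predE : (now st).-1%:R = (now st)%:R - 1 :> R by rewrite -subn1 natrB.
have le_nowR : (mseq st)%:R <= (now st)%:R :> R by rewrite ler_nat.
rewrite predE in le_mseq.
(* From t = now + mseq + 1 and mseq <= now comes t - 3 <= 2 (now - 1), which [balanced] bounds by 2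
   balance mseq^2; this explains the shift by 3. Adding 1 to [balance] makes the factor positive. *)
have t_mseq : t%:R - 3 <= 2 * (balance + 1) * (mseq st)%:R ^+ 2.
  rewrite -[leRHS]mulrA [(balance + 1) * _]mulrDl mul1r tE.
  have := sqr_ge0 ((mseq st)%:R : R).
  move: le_mseq le_nowR; move: ((mseq st)%:R ^+ 2) => v.
  by move: (balance * v) => u; lra.
have t_now : t%:R - 3 <= 2 * (now st)%:R :> R by rewrite tE; move: le_nowR; lra.
split.
- rewrite -ler_sqr ?nnegrE ?mulr_ge0 ?sqrtr_ge0 ?(ltW w_gt0) ?(ltW eps0)//.
  rewrite exprMn rdt radius_sqr//.
  have hlog : log t <= 2 * eps ^+ 2 / width a b ^+ 2 * (mseq st)%:R.
    rewrite -ler_sqr ?nnegrE ?(ltW L0)//; last first.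
      by rewrite !mulr_ge0 ?invr_ge0 ?exprn_ge0 ?(ltW eps0) ?(ltW w_gt0).
    apply: le_trans log1 _; rewrite exprMn /eta1 -[leLHS]mulrA.
    rewrite ler_wpM2l ?sqr_ge0// mulrC ler_pdivrMr ?mulr_gt0//.
    by rewrite mulrC.
  rewrite mulrA ler_pdivrMr ?mulr_gt0// mulrC -ler_pdivlMr ?exprn_gt0//.
  by apply: le_trans hlog _; rewrite le_eqVlt; apply/orP; left; apply/eqP; ring.
- rewrite -ler_sqr ?nnegrE ?mulr_ge0 ?sqrtr_ge0 ?(ltW (width_theta_gt0 st)) ?(ltW eps0)//.
  rewrite exprMn rdt radius_sqr//.
  pose s : R := Num.sqrt (now st)%:R.
  have s0 : 0 < s by rewrite sqrtr_gt0.
  have s2 : (now st)%:R = s ^+ 2 by rewrite sqr_sqrtr// ltW.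
  have hlog : log t <= 2 * eps ^+ 2 / growth * s.
    rewrite -ler_sqr ?nnegrE ?(ltW L0)//; last first.
      by rewrite !mulr_ge0 ?invr_ge0 ?exprn_ge0 ?(ltW eps0) ?(ltW growth_gt0) ?(ltW s0).
    apply: le_trans log2 _; rewrite exprMn /eta2 -[leLHS]mulrA -s2.
    by rewrite ler_wpM2l ?sqr_ge0// mulrC ler_pdivrMr// mulrC.
  apply: (@le_trans _ _ (growth * s * (log t / (2 * (now st)%:R)))).
    rewrite ler_wpM2r ?width_theta_sqr_le// divr_ge0 ?(ltW L0)//.
  rewrite mulrA ler_pdivrMr ?mulr_gt0// s2.
  apply: le_trans (ler_wpM2l _ hlog) _; first by rewrite mulr_ge0// ltW.
  rewrite le_eqVlt; apply/orP; left; apply/eqP; field; exact: lt0r_neq0.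
Qed.

Lemma ADE_returns_outliers : (forall i, means i <> theta) ->
  ADE_returns a b k delta x y [set i | theta <= means i]%SET.
Proof.
move=> sep.
suff [j cand0] : exists j, cand (ADE_state a b k delta x y j) = finset.set0.
  have ret : ADE_returns a b k delta x y (outlier_set (ADE_state a b k delta x y j)).
    by exists j.
  by rewrite -(ADE_returns_correct ret).
(* Two radii of each kind must fit into the gap of every arm, hence a quarter of the smallest
   gap. *)
pose eps := \big[Num.min/1]_(i < n) (`|theta - means i| / 4).
have eps0 : 0 < eps.
  rewrite /eps; elim/big_rec: _ => // i z _ z0.
  rewrite lt_min z0 andbT divr_gt0// normr_gt0 subr_eq0 eq_sym.
  exact/eqP/sep.
have eps_le i : 4 * eps <= `|theta - means i|.
  by rewrite mulrC -ler_pdivlMr// /eps; exact: bigmin_le_cond.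
have [t t4 small] := eventually_classified eps0.
(* [ADE_state j] is in round j + 3 while candidates remain, so its next pass classifies in round j +
   4 = t. *)
case: t t4 small => [|[|[|[|j]]]]// _ small.
have [cand0|candn0] := eqVneq (cand (ADE_state a b k delta x y j)) finset.set0.
  by exists j.
exists j.+1; rewrite /ADE_state iterS -/(ADE_state _ _ _ _ _ _ _) ifN//.
have rdj := round_ADE_state candn0.
have := invariant_sampled (invariant_ADE_state j).
rewrite /loop_body -/(sampled _).
have : round (sampled (ADE_state a b k delta x y j)) = j.+4.
  by rewrite /sampled; case: ifP => _; rewrite /round /= size_rcons -/(round _) rdj.
move: (sampled _) => st rdst [cst bst _ _].
have [le1 le2] := small st cst bst rdst.
apply/setP => i; rewrite !inE; apply/negP => /and3P[ic inorm iout].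
have := @classified st i cst ic; rewrite (negbTE inorm) (negbTE iout)/= => absurd.
suff : false by []; apply: absurd.
by apply: le_trans (eps_le i); lra.
Qed.

End ADE_run.

(** * Measurability of the run *)

Section measurability.
Context d (T : measurableType d).

Lemma measurable_cst_prop (Q : Prop) : measurable [set _ : T | Q].
Proof.
have [q|nq] := pselect Q.
  by rewrite (_ : [set _ | _] = setT)//; apply/seteqP; split.
by rewrite (_ : [set _ | _] = set0)//; apply/seteqP; split.
Qed.

Lemma measurable_preimage_true (f : T -> bool) :
  measurable_fun setT f -> measurable [set w | f w].
Proof. by move=> mf; rewrite -[X in measurable X]setTI; exact: mf. Qed.

(** A random state is fed into a map that is itself random; splitting on the countably many values
    of the state leaves events in which the state is fixed. *)
Lemma measurable_countable_comp (S S' : Type) (f : T -> S) (g : T -> S -> S') :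
  countable [set: S] -> (forall s, measurable [set w | f w = s]) ->
  (forall s s', measurable [set w | g w s = s']) ->
  forall s', measurable [set w | g w (f w) = s'].
Proof.
move=> cS mf mg s'.
rewrite (_ : [set w | _] =
    \bigcup_s ([set w | f w = s] `&` [set w | g w s = s'])).
  by apply: countable_bigcupT_measurable => // s; exact: measurableI.
apply/seteqP; split=> [w /= gw|w [s _ [/= <-]]//].
by exists (f w).
Qed.

Lemma countable_state n : countable [set: state n].
Proof.
apply/countable_injP.
exists (fun st => choice.pickle (mtheta st, mseq st, marm st, cand st,
                          normal_set st, outlier_set st)).
move=> [? ? ? ? ? ?] [? ? ? ? ? ?] _ _ /(pcan_inj choice.pickleK).
by case=> -> -> -> -> -> ->.
Qed.

Context {R : realType} {n : nat}.
Variables (a b k delta : R).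
Variables (x1 x2 : nat -> T -> R) (y : 'I_n -> nat -> T -> R).
Hypothesis mx1 : forall l, measurable_fun setT (x1 l).
Hypothesis mx2 : forall l, measurable_fun setT (x2 l).
Hypothesis my : forall i l, measurable_fun setT (y i l).

Let X w l := (x1 l w, x2 l w).
Let Y w i l := y i l w.

Implicit Type st : state n.

(** The inverse becomes a real power, measurable on the whole line; at 0 both expressions are 0. *)
Lemma measurable_invr_sqrt (f : T -> R) : measurable_fun setT f ->
  measurable_fun setT (fun w => (Num.sqrt (f w))^-1).
Proof.
move=> mf; under eq_fun do rewrite -powR_inv1 ?sqrtr_ge0//.
apply: (measurableT_comp (measurable_powR (-1))).
exact: (measurableT_comp (continuous_measurable_fun (@sqrt_continuous R)) mf).
Qed.

Lemma measurable_sigma_hat m : measurable_fun setT (fun w => sigma_hat (X w) m).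
Proof.
apply: (measurableT_comp (continuous_measurable_fun (@sqrt_continuous R))).
apply: measurableT_comp => //; apply: measurable_funB.
  apply: measurable_funM => //; apply: measurable_sum => l.
  exact: measurable_funM (mx1 l) (mx2 l).
apply: measurable_funM => //; apply: measurable_sum => l.
by apply: measurable_sum => h; exact: measurable_funM (mx1 l) (mx2 h).
Qed.

Lemma measurable_theta_hat m : measurable_fun setT (fun w => theta_hat k (X w) m).
Proof.
apply: measurable_funD.
  by apply: measurable_funM => //; apply: measurable_sum => l; exact: mx1.
by apply: measurable_funM => //; exact: measurable_sigma_hat.
Qed.

Lemma measurable_U_sigma st :
  measurable_fun setT (fun w => U_sigma a b delta (X w) st).
Proof.
rewrite /U_sigma; elim: (round st).+1 => [|t IH].
  by under eq_fun do rewrite big_geq//; exact: measurable_cst.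
case: t IH => [|t] IH; first by
  under eq_fun do rewrite big_geq//; exact: measurable_cst.
under eq_fun do rewrite big_nat_recr//=.
apply: measurable_mine => //; apply: emeasurable_funD => //.
apply/measurable_EFinP; apply: (measurable_funX 2).
exact: measurable_sigma_hat.
Qed.

Lemma measurable_r_theta st :
  measurable_fun setT (fun w => r_theta a b k delta (X w) st).
Proof.
rewrite /r_theta /conf_radius; case: (_ == 0%N); first exact: measurable_cst.
apply/measurable_EFinP; apply: measurable_funM => //.
apply: measurable_funD => //; apply: measurable_funM => //.
apply: measurable_funM => //; apply: measurable_invr_sqrt.
apply: measurableT_comp => //; exact: measurable_U_sigma.
Qed.

Lemma measurable_arm_bound st i :
  measurable_fun setT (fun w => (arm_estimate (Y w) i (marm st i))%:E).
Proof.
apply/measurable_EFinP; apply: measurable_funM => //.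
by apply: measurable_sum => l; exact: my.
Qed.

Lemma measurable_is_normal st i :
  measurable_fun setT (fun w => is_normal a b k delta (X w) (Y w) st i).
Proof.
apply: measurable_fun_lee.
  by apply: emeasurable_funD => //; exact: measurable_arm_bound.
apply: emeasurable_funB; last exact: measurable_r_theta.
by apply/measurable_EFinP; exact: measurable_theta_hat.
Qed.

Lemma measurable_is_outlier st i :
  measurable_fun setT (fun w => is_outlier a b k delta (X w) (Y w) st i).
Proof.
apply: measurable_and; first by apply: measurable_neg; exact: measurable_is_normal.
apply: measurable_fun_lee.
  apply: emeasurable_funD; last exact: measurable_r_theta.
  by apply/measurable_EFinP; exact: measurable_theta_hat.
by apply: emeasurable_funB => //; exact: measurable_arm_bound.
Qed.

(** For a fixed state the outcome matters only through the finite table [tests] of boolean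
    results. *)
Lemma measurable_classify st st' :
  measurable [set w | classify a b k delta (X w) (Y w) st = st'].
Proof.
pose tests w : {ffun 'I_n -> bool * bool} :=
  [ffun i => (is_normal a b k delta (X w) (Y w) st i,
              is_outlier a b k delta (X w) (Y w) st i)].
pose assign (t : {ffun 'I_n -> bool * bool}) : state n :=
  State (mtheta st) (mseq st) (marm st)
    [set i in cand st | ~~ (t i).1 && ~~ (t i).2]%SET
    (normal_set st :|: [set i in cand st | (t i).1])%SET
    (outlier_set st :|: [set i in cand st | (t i).2])%SET.
rewrite (_ : [set w | _] = [set w | assign (tests w) = st']).
  apply: (@measurable_countable_comp _ _ tests (fun _ => assign)) => //.
    move=> t; rewrite (_ : [set w | _] =
      \bigcap_(i in [set: 'I_n])
      ([set w | is_normal a b k delta (X w) (Y w) st i == (t i).1]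
       `&` [set w | is_outlier a b k delta (X w) (Y w) st i == (t i).2])).
      apply: fin_bigcap_measurable => // i _.
      have meq (f : T -> bool) c :
          measurable_fun setT f -> measurable [set w | f w == c].
        case: c => mf; first by
          under eq_set do rewrite eqb_id; exact: measurable_preimage_true.
        under eq_set do rewrite eqbF_neg.
        by apply: measurable_preimage_true; exact: measurable_neg.
      apply: measurableI; apply: meq.
        exact: measurable_is_normal.
      exact: measurable_is_outlier.
    apply/seteqP; split=> [w /= <- i _|w /= tw].
      by rewrite /tests ffunE /= !eqxx.
    apply/ffunP => i; rewrite /tests ffunE; have [/eqP -> /eqP ->] := tw i I.
    by case: (t i).
  by move=> s s'; exact: measurable_cst_prop.
apply/seteqP; split=> w /= <-; rewrite /classify /assign /tests;
  by congr State; [|congr (_ :|: _)..]; apply/setP => i; rewrite !inE ffunE.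
Qed.

Lemma measurable_loop_body st st' :
  measurable [set w | loop_body a b k delta (X w) (Y w) st = st'].
Proof.
pose rnd w := (r_seq a b delta st <= r_theta a b k delta (X w) st)%E.
have mrnd : measurable_fun setT rnd.
  by apply: measurable_fun_lee => //; exact: measurable_r_theta.
rewrite /loop_body (_ : [set w | _] =
  ([set w | rnd w] `&`
     [set w | classify a b k delta (X w) (Y w) (random_sample st) = st']) `|`
  ([set w | ~~ rnd w] `&`
     [set w | classify a b k delta (X w) (Y w) (sequential_sample st) = st'])).
  apply: measurableU; apply: measurableI; try exact: measurable_classify.
    exact: measurable_preimage_true.
  by apply: measurable_preimage_true; exact: measurable_neg.
apply/seteqP; split=> w /=; rewrite -/(rnd w); case: (rnd w) => //=.
- by move=> ?; left.
- by move=> ?; right.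
- by case=> [[]|[]].
- by case=> [[]|[]].
Qed.

Lemma measurable_ADE_state j st :
  measurable [set w | ADE_state a b k delta (X w) (Y w) j = st].
Proof.
elim: j st => [|j IH] st; first exact: (measurable_cst_prop (initial = st)).
rewrite /ADE_state/=.
apply: (@measurable_countable_comp _ _
  (fun w => ADE_state a b k delta (X w) (Y w) j)
  (fun w st => if cand st == finset.set0 then st
               else loop_body a b k delta (X w) (Y w) st)) => //.
- exact: countable_state.
- move=> s s'; case: (cand s == finset.set0); first exact: (measurable_cst_prop (s = s')).
  exact: measurable_loop_body.
Qed.

Lemma measurable_ADE_returns O :
  measurable [set w | ADE_returns a b k delta (X w) (Y w) O].
Proof.
rewrite (_ : [set w | _] = \bigcup_j \bigcup_(st in [set st : state n |
    cand st = finset.set0 /\ outlier_set st = O])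
      [set w | ADE_state a b k delta (X w) (Y w) j = st]).
  apply: bigcupT_measurable => j; rewrite bigcup_mkcond.
  apply: countable_bigcupT_measurable => [|st]; first exact: countable_state.
  by case: ifP => // _; exact: measurable_ADE_state.
apply/seteqP; split=> w.
  by move=> [j [c0 oO]]; exists j => //; exists (ADE_state a b k delta (X w) (Y w) j).
by move=> [j _ [st /= [c0 oO] Est]]; exists j; rewrite Est.
Qed.

Lemma measurable_only_returns O :
  measurable [set w | forall Q, ADE_returns a b k delta (X w) (Y w) Q -> Q = O].
Proof.
rewrite (_ : [set w | _] = ~` \bigcup_(Q in [set Q | Q <> O])
    [set w | ADE_returns a b k delta (X w) (Y w) Q]).
  apply: measurableC; rewrite bigcup_mkcond.
  apply: countable_bigcupT_measurable => // Q.
  by case: ifP => // _; exact: measurable_ADE_returns.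
apply/seteqP; split=> w /=.
  by move=> all_O [Q /= neO] ret; apply: neO; exact: all_O.
by move=> nex Q ret; apply: contrapT => neO; apply: nex; exists Q.
Qed.

End measurability.

(** * Concentration of the samples *)

Lemma independent_seq_family d (T : measurableType d) (R : realType)
    (P : probability T R) (I : choiceType) (F : I -> set_system T)
    (inj : nat -> I) (X : nat -> T -> R) :
  injective inj -> mutually_independent P F ->
  (forall l B, measurable B -> F (inj l) (X l @^-1` B)) -> independent_seq P X.
Proof.
move=> inj_inj indF FX N B mB.
(* The intersection extends the events to all of [I] without a partial inverse of [inj]: by
   injectivity it has a single term at [inj l]. *)
pose E j := \bigcap_(l in [set l | inj l = j]) X l @^-1` B l.
have EE l : E (inj l) = X l @^-1` B l.
  apply/seteqP; split=> w; first by apply.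
  by move=> XB l' /= /inj_inj ->.
pose J := [fset j in map inj (iota 0 N)]%fset.
have permJ : perm_eq J (map inj (iota 0 N)).
  apply: uniq_perm; rewrite ?fset_uniq ?map_inj_uniq ?iota_uniq// => j.
  by rewrite !inE.
have : P (\big[setI/setT]_(j <- J) E j) = (\prod_(j <- J) P (E j))%E.
  by apply: indF => j; rewrite !inE => /mapP[l _ ->]; rewrite EE; exact: FX.
rewrite !(perm_big _ permJ)/= !big_map => indJ.
rewrite -(big_mkord xpredT (fun l => X l @^-1` B l)).
rewrite -(big_mkord xpredT (fun l => P (X l @^-1` B l))) /index_iota subn0.
under eq_bigr do rewrite -EE.
under [in RHS]eq_bigr do rewrite -EE.
exact: indJ.
Qed.

Section clamp.
Context {R : realType}.
Variables a b : R.
Hypothesis ab : a < b.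

(* The rewards lie in [a, b] only almost surely; their clamped versions lie in
   it everywhere. *)
Definition clamp (z : R) : R := Num.min (Num.max z a) b.

Lemma clamp_bounded z : a <= clamp z <= b.
Proof.
by rewrite /clamp le_min le_max lexx orbT (ltW ab)/= ge_min lexx orbT.
Qed.

Lemma clamp_id z : a <= z <= b -> clamp z = z.
Proof. by move=> /andP[az zb]; rewrite /clamp max_l// min_l. Qed.

Lemma measurable_clamp : measurable_fun setT clamp.
Proof.
by apply: measurable_minr => //; apply: measurable_maxr.
Qed.

Variable nu : probability (measurableTypeR R) R.
Hypothesis nu_bounded : nu `[a, b]%classic = 1%E.

Lemma integral_clamp : (\int[nu]_z (clamp z)%:E = (\int[nu]_z z)%:E)%E.
Proof.
have iclamp : nu.-integrable setT (EFin \o clamp).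
  exact: (bounded_integrable nu measurable_clamp clamp_bounded).
have Eae : (\int[nu]_z (clamp z)%:E = \int[nu]_z z%:E)%E.
  apply: ae_eq_integral => //.
  - by case/integrableP: iclamp.
  - exists (~` `[a, b]%classic); split.
    + exact: measurableC.
    + have nuC : nu (~` `[a, b]%classic) = 0%E.
        by rewrite probability_setC// nu_bounded subee.
      exact: nuC.
    + move=> z /=; apply: contra_not; rewrite in_itv/= => zab _.
      by rewrite clamp_id.
by rewrite /Rintegral -Eae fineK//; exact: integrable_fin_num.
Qed.

Lemma mean_bounded : a <= \int[nu]_z z <= b.
Proof.
have icst c := finite_measure_integrable_cst nu c.
have iclamp : nu.-integrable setT (EFin \o clamp).
  exact: (bounded_integrable nu measurable_clamp clamp_bounded).
rewrite -!lee_fin -integral_clamp.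
rewrite -[a%:E]mule1 -[b%:E]mule1 -(probability_setT nu) -!integral_cst//.
apply/andP; split; apply: le_integral => //.
- exact: icst.
- by move=> z _; rewrite lee_fin; case/andP: (clamp_bounded z).
- exact: icst.
- by move=> z _; rewrite lee_fin; case/andP: (clamp_bounded z).
Qed.

End clamp.

(** * Expectations under the sampling law *)

Section samples.
Context {R : realType} {n : nat} d (T : measurableType d) (P : probability T R).
Variable nu : 'I_n -> probability (measurableTypeR R) R.
Variables (A : nat -> T -> 'I_n) (x1 x2 : nat -> {RV P >-> R}).
Variable y : 'I_n -> nat -> {RV P >-> R}.
Hypothesis samples : sampling nu A x1 x2 y.

(** The law is given on rectangles and is extended to functions one coordinate at a time: first to
    [f] with the event on [x2] in the weight, then to [g] with [f] in the weight. Finiteness of the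
    integral of [f] makes it an admissible constant in the second transfer. *)
Lemma integral_arm_pair l i (f g : R -> R) :
  measurable_fun setT f -> (forall z, 0 <= f z) ->
  measurable_fun setT g -> (forall z, 0 <= g z) ->
  (\int[nu i]_z (f z)%:E < +oo)%E ->
  (\int[P]_w ((\1_(A l @^-1` [set i]) w * f (x1 l w))%:E * (g (x2 l w))%:E) =
    (n%:R^-1)%:E * \int[nu i]_z (f z)%:E * \int[nu i]_z (g z)%:E)%E.
Proof.
move=> mf f0 mg g0 foo.
have mAi : measurable (A l @^-1` [set i]) by exact: arm_choice_measurable samples l i.
have int0 : (0 <= \int[nu i]_z (f z)%:E)%E.
  by apply: integral_ge0 => z _; rewrite lee_fin.
have n0 : (0 <= (n%:R^-1)%:E :> \bar R)%E by rewrite lee_fin.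
apply: (@ge0_integral_transfer R _ _ _ T _ _ P (nu i) (x2 l) idfun
  (fun w => \1_(A l @^-1` [set i]) w * f (x1 l w))
  ((n%:R^-1)%:E * \int[nu i]_z (f z)%:E)%E (EFin \o g)) => //.
- exact: measurable_id.
- by apply: measurable_funM => //; exact: measurableT_comp.
- by move=> w; rewrite mulr_ge0.
- by rewrite mule_ge0.
- by rewrite fin_numM// ge0_fin_numE.
- move=> B2 mB2.
  have mx2B : measurable (x2 l @^-1` B2).
    by rewrite -[_ @^-1` _]setTI; exact: measurable_funPT.
  transitivity (\int[P]_w ((\1_(A l @^-1` [set i]) w * \1_B2 (x2 l w))%:E *
      (f (x1 l w))%:E))%E.
    by apply: eq_integral => w _; rewrite -!EFinM mulrAC.
  transitivity ((n%:R^-1)%:E * nu i B2 * \int[nu i]_z (f z)%:E)%E; last by rewrite muleAC.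
  apply: (@ge0_integral_transfer R _ _ _ T _ _ P (nu i) (x1 l) idfun
    (fun w => \1_(A l @^-1` [set i]) w * \1_B2 (x2 l w))
    ((n%:R^-1)%:E * nu i B2)%E (EFin \o f)) => //.
  + exact: measurable_id.
  + apply: measurable_funM => //.
    by apply: (measurableT_comp (measurable_indic mB2)) => //; exact: measurable_funPT.
  + by rewrite mule_ge0.
  + by rewrite fin_numM// fin_num_measure.
  + move=> B1 mB1.
    have mx1B : measurable (x1 l @^-1` B1).
      by rewrite -[_ @^-1` _]setTI; exact: measurable_funPT.
    transitivity (P (A l @^-1` [set i] `&` x1 l @^-1` B1 `&` x2 l @^-1` B2)).
      rewrite -[X in P X]setIT -integral_indic//; last first.
        by apply: measurableI => //; exact: measurableI.
      apply: eq_integral => w _; rewrite -EFinM; congr EFin.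
      rewrite !indicI/= mulrAC -!mulrA; congr (_ * _).
    by rewrite (random_sample_law samples)// muleAC.
  + exact/measurable_EFinP.
- exact/measurable_EFinP.
Qed.

Lemma integral_random_pair l (f g : R -> R) :
  measurable_fun setT f -> (forall z, 0 <= f z) ->
  measurable_fun setT g -> (forall z, 0 <= g z) ->
  (forall i, \int[nu i]_z (f z)%:E < +oo)%E ->
  (\int[P]_w (f (x1 l w) * g (x2 l w))%:E =
    \sum_(i < n) (n%:R^-1)%:E * \int[nu i]_z (f z)%:E * \int[nu i]_z (g z)%:E)%E.
Proof.
move=> mf f0 mg g0 foo.
under [RHS]eq_bigr do rewrite -(integral_arm_pair l)//.
rewrite -ge0_integral_sum//.
- apply: eq_integral => w _.
  under eq_bigr do rewrite -EFinM.
  rewrite sumEFin; congr EFin; rewrite (bigD1 (A l w))//= big1 ?addr0.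
    by rewrite indicE mem_set// mul1r.
  move=> i iA; rewrite indicE memNset ?mul0r//= => Ai.
  by rewrite -Ai eqxx in iA.
- move=> i; have mAi : measurable (A l @^-1` [set i]).
    exact: arm_choice_measurable samples l i.
  apply: emeasurable_funM; apply/measurable_EFinP.
    by apply: measurable_funM => //; exact: measurableT_comp.
  exact: measurableT_comp.
- by move=> i w _; rewrite -EFinM lee_fin !mulr_ge0.
Qed.

Lemma integral_sequential i l (f : R -> R) :
  measurable_fun setT f -> (forall z, 0 <= f z) ->
  (\int[P]_w (f (y i l w))%:E = \int[nu i]_z (f z)%:E)%E.
Proof.
move=> mf f0.
have := @ge0_integral_transfer R _ _ _ _ _ _ P (nu i) (y i l) idfun (cst 1) 1%E
  (EFin \o f).
rewrite mul1e /= => <- //.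
- by apply: eq_integral => w _; rewrite mul1e.
- exact: measurable_id.
- move=> B mB; have mXB : measurable (y i l @^-1` B).
    by rewrite -[_ @^-1` _]setTI; exact: measurable_funPT.
  rewrite mul1e -(sequential_sample_law samples i l mB).
  rewrite -[X in P X]setIT -integral_indic//.
  by apply: eq_integral => w _; rewrite mul1e.
- exact/measurable_EFinP.
Qed.

End samples.

(** * The failure event and its probability *)

Section good_event.
Context {R : realType} {n : nat} (a b delta : R).
Context d (T : measurableType d) (P : probability T R).
Variable nu : 'I_n -> probability (measurableTypeR R) R.
Variables (A : nat -> T -> 'I_n) (x1 x2 : nat -> {RV P >-> R}).
Variable y : 'I_n -> nat -> {RV P >-> R}.
Hypotheses (a_ge0 : 0 <= a) (ab : a < b).
Hypothesis delta01 : 0 < delta < 1.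
Hypothesis nu_bounded : forall i, nu i `[a, b]%classic = 1%E.
Hypothesis samples : sampling nu A x1 x2 y.

Let c := clamp a b.
Let mc : measurable_fun setT c. Proof. exact: measurable_clamp. Qed.
Let c_bounded z : a <= c z <= b. Proof. exact: clamp_bounded. Qed.
Let c_ge0 z : 0 <= c z.
Proof. by have /andP[az _] := c_bounded z; exact: le_trans az. Qed.

Let outside := \bigcup_l
  ((x1 l @^-1` (~` `[a, b]%classic) `|` x2 l @^-1` (~` `[a, b]%classic))
  `|` \big[setU/set0]_(i < n) y i l @^-1` (~` `[a, b]%classic)).

(** The n + 3 families. In the last one both clamped factors lie in [a, b] with a >= 0, so the
    product has range [a^2, b^2], whose length is [width_sq]. *)
Let deviates (p : 'I_n + 'I_3) : set T :=
  match p with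
  | inl i => deviation_event n delta a b (arm_mean nu i) (fun l w => c (y i l w))
  | inr j =>
    if j == 0 :> nat then
      deviation_event n delta a b (mu_y nu) (fun l w => c (x1 l w))
    else if j == 1%N :> nat then
      deviation_event n delta a b (mu_y nu) (fun l w => c (x2 l w))
    else
      deviation_event n delta (a ^+ 2) (b ^+ 2)
        (n%:R^-1 * \sum_(i < n) arm_mean nu i ^+ 2)
        (fun l w => c (x1 l w) * c (x2 l w))
  end.

Definition failure : set T := outside `|` \big[setU/set0]_p deviates p.

Let mX1 l : measurable_fun setT (x1 l). Proof. exact: measurable_funPT. Qed.
Let mX2 l : measurable_fun setT (x2 l). Proof. exact: measurable_funPT. Qed.
Let mY i l : measurable_fun setT (y i l). Proof. exact: measurable_funPT. Qed.

Let m_out : measurable (~` `[a, b]%classic : set R).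
Proof. exact: measurableC. Qed.

Let measurable_pre (X : T -> R) B : measurable_fun setT X -> measurable B ->
  measurable (X @^-1` B).
Proof. by move=> mX mB; rewrite -[_ @^-1` _]setTI; exact: mX. Qed.

Lemma measurable_outside : measurable outside.
Proof.
apply: bigcupT_measurable => l; apply: measurableU.
  by apply: measurableU; exact: measurable_pre.
by apply: bigsetU_measurable => i _; exact: measurable_pre.
Qed.

Lemma measurable_deviates p : measurable (deviates p).
Proof.
case: p => [i|j] /=.
  by apply: measurable_deviation_event => l; exact: measurableT_comp.
do 2?case: ifP => _; apply: measurable_deviation_event => l.
- exact: measurableT_comp.
- exact: measurableT_comp.
- by apply: measurable_funM; exact: measurableT_comp.
Qed.

Lemma measurable_failure : measurable failure.
Proof.
apply: measurableU; first exact: measurable_outside.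
by apply: bigsetU_measurable => p _; exact: measurable_deviates.
Qed.

Lemma integral_nu_one i : (\int[nu i]_z (1 : R)%:E = 1)%E.
Proof. by rewrite integral_cst// mul1e; exact: probability_setT. Qed.

Lemma integral_nu_clamp i : (\int[nu i]_z (c z)%:E = (arm_mean nu i)%:E)%E.
Proof. exact: integral_clamp. Qed.

Lemma integral_x1 l (f : R -> R) : measurable_fun setT f -> (forall z, 0 <= f z) ->
  (forall i, \int[nu i]_z (f z)%:E < +oo)%E ->
  (\int[P]_w (f (x1 l w))%:E =
    \sum_(i < n) (n%:R^-1)%:E * \int[nu i]_z (f z)%:E)%E.
Proof.
move=> mf f0 foo.
have := integral_random_pair samples l mf f0 (measurable_cst (1 : R)) (fun=> ler01) foo.
under eq_integral do rewrite mulr1.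
by move=> ->; apply: eq_bigr => i _; rewrite integral_nu_one mule1.
Qed.

Lemma integral_x2 l (f : R -> R) : measurable_fun setT f -> (forall z, 0 <= f z) ->
  (\int[P]_w (f (x2 l w))%:E =
    \sum_(i < n) (n%:R^-1)%:E * \int[nu i]_z (f z)%:E)%E.
Proof.
move=> mf f0.
have oneoo i : (\int[nu i]_z (1 : R)%:E < +oo)%E by rewrite integral_nu_one ltry.
have := integral_random_pair samples l (measurable_cst (1 : R)) (fun=> ler01) mf f0 oneoo.
under eq_integral do rewrite mul1r.
by move=> ->; apply: eq_bigr => i _; rewrite integral_nu_one mule1.
Qed.

Let nu_outside i : nu i (~` `[a, b]%classic) = 0%E.
Proof. by rewrite probability_setC// nu_bounded subee. Qed.

Let ind_out : R -> R := \1_(~` `[a, b]%classic).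

Let integral_out (X : T -> R) : measurable_fun setT X ->
  (\int[P]_w (ind_out (X w))%:E = P (X @^-1` (~` `[a, b]%classic)))%E.
Proof.
move=> mX; rewrite -[X in P X]setIT -integral_indic//; exact: measurable_pre.
Qed.

Let integral_nu_out i : (\int[nu i]_z (ind_out z)%:E = 0)%E.
Proof. by rewrite integral_indic// setIT; exact: nu_outside. Qed.

Let mind : measurable_fun setT ind_out. Proof. exact: measurable_indic. Qed.
Let ind0 z : 0 <= ind_out z. Proof. by rewrite /ind_out indicE. Qed.

Lemma negligible_outside : P outside = 0%E.
Proof.
have sum_out : (\sum_(i < n) (n%:R^-1)%:E * \int[nu i]_z (ind_out z)%:E = 0)%E.
  by rewrite big1// => i _; rewrite integral_nu_out mule0.
have outoo i : (\int[nu i]_z (ind_out z)%:E < +oo)%E by rewrite integral_nu_out.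
apply/negligibleP; first exact: measurable_outside.
apply: negligible_bigcup => l; apply: negligibleU; first apply: negligibleU.
- apply/negligibleP; first exact: measurable_pre.
  by rewrite -[LHS](integral_out (mX1 l)) integral_x1.
- apply/negligibleP; first exact: measurable_pre.
  by rewrite -[LHS](integral_out (mX2 l)) integral_x2.
- elim/big_ind: _ => [|B1 B2 N1 N2|i _]; first exact: negligible_set0.
    exact: negligibleU.
  apply/negligibleP; first exact: measurable_pre.
  by rewrite [LHS](sequential_sample_law samples)// nu_outside.
Qed.

Lemma deviates_le p : (P (deviates p) <= (delta / (n + 4)%:R)%:E)%E.
Proof.
have nu_oo i : (\int[nu i]_z (c z)%:E < +oo)%E by rewrite integral_nu_clamp ltry.
have b_gt0 : 0 < b by exact: le_lt_trans ab.
have indep := samples_independent samples.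
have EX1 l : (\int[P]_w (c (x1 l w))%:E = (mu_y nu)%:E)%E.
  rewrite integral_x1//; under eq_bigr do rewrite integral_nu_clamp -EFinM.
  by rewrite sumEFin -mulr_sumr.
have EX2 l : (\int[P]_w (c (x2 l w))%:E = (mu_y nu)%:E)%E.
  rewrite integral_x2//; under eq_bigr do rewrite integral_nu_clamp -EFinM.
  by rewrite sumEFin -mulr_sumr.
have EX12 l : (\int[P]_w (c (x1 l w) * c (x2 l w))%:E =
    (n%:R^-1 * \sum_(i < n) arm_mean nu i ^+ 2)%:E)%E.
  rewrite (integral_random_pair samples)//.
  under eq_bigr do rewrite integral_nu_clamp -!EFinM -mulrA -expr2.
  by rewrite sumEFin -mulr_sumr.
have inj_inl : injective (fun l : nat => inl l : nat + 'I_n * nat) by move=> l l' [].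
have indep_pair (h : R * R -> R) : measurable_fun setT h ->
    independent_seq P (fun l w => h (x1 l w, x2 l w)).
  move=> mh; apply: (independent_seq_family inj_inl indep) => l B mB.
  (* The event constrains the rewards alone, so its section is the same for every drawn arm. *)
  exists (fun=> h @^-1` B); split=> // i.
  by rewrite -[_ @^-1` _]setTI; exact: mh.
have mc1 : measurable_fun setT (fun p : R * R => c p.1).
  exact: measurableT_comp.
have mc2 : measurable_fun setT (fun p : R * R => c p.2).
  exact: measurableT_comp.
case: p => [i|j] /=.
  apply: deviation_event_le => //.
  - by move=> l; exact: measurableT_comp.
  - have inj_inr : injective (fun l => inr (i, l) : nat + 'I_n * nat) by move=> l l' [].
    apply: (independent_seq_family inj_inr indep) => l B mB.
    exists (c @^-1` B); last by rewrite setTI.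
    by rewrite -[_ @^-1` _]setTI; exact: mc.
  - by move=> l; rewrite (integral_sequential samples)// integral_nu_clamp.
do 2?case: ifP => _; apply: deviation_event_le => //.
- by move=> l; exact: measurableT_comp.
- exact: indep_pair mc1.
- by move=> l; exact: measurableT_comp.
- exact: indep_pair mc2.
- by move=> l; apply: measurable_funM; exact: measurableT_comp.
- exact: indep_pair (measurable_funM mc1 mc2).
- by rewrite ltr_sqr ?nnegrE// ltW.
- move=> l w; have /andP[h1 h2] := c_bounded (x1 l w).
  have /andP[h3 h4] := c_bounded (x2 l w).
  by rewrite !expr2 !ler_pM.
Qed.

Lemma failure_le : (P failure <= delta%:E)%E.
Proof.
have /andP[d0 d1] := delta01.
apply: le_trans (measureU2 _ _ _) _.
- exact: measurable_outside.
- by apply: bigsetU_measurable => p _; exact: measurable_deviates.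
rewrite [X in (X + _)%E]negligible_outside add0e.
apply: (@le_trans _ _ (\sum_(p : 'I_n + 'I_3) (delta / (n + 4)%:R)%:E)%E).
  suff [_ le_sum] : measurable (\big[setU/set0]_p deviates p) /\
    (P (\big[setU/set0]_p deviates p) <=
       \sum_(p : 'I_n + 'I_3) (delta / (n + 4)%:R)%:E)%E by [].
  elim/big_ind2: _ => [|A1 s1 A2 s2 [m1 le1] [m2 le2]|p _].
  - by rewrite measure0.
  - split; first exact: measurableU.
    by apply: le_trans (measureU2 _ m1 m2) _; exact: leeD.
  - by split; [exact: measurable_deviates|exact: deviates_le].
(* There are n + 3 families at [delta / (n + 4)] each. *)
rewrite sumEFin sumr_const lee_fin card_sum !card_ord -[leLHS]mulr_natl.
have n4 : 0 < (n + 4)%:R :> R by rewrite ltr0n addn4.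
rewrite mulrA ler_pdivrMr// mulrC ler_pM2l// ler_nat leq_add2l//.
Qed.

(** Outside the null event clamping changes no sample, so the bounds on clamped averages hold for
    the actual ones. *)
Lemma not_failure_concentrated w : ~ failure w ->
  concentrated a b delta (fun l => (x1 l w, x2 l w)) (fun i l => y i l w) (arm_mean nu).
Proof.
move=> /not_orP[inside close].
have {}close p : ~ deviates p w.
  by move=> dev; apply: close; by rewrite (bigD1 p)//=; left.
have in_ab (X : T -> R) : ~ (X @^-1` (~` `[a, b]%classic)) w -> a <= X w <= b.
  by move=> /contrapT /=; rewrite in_itv.
have x1_ab l : a <= x1 l w <= b.
  by apply: in_ab => out; apply: inside; exists l => //; left; left.
have x2_ab l : a <= x2 l w <= b.
  by apply: in_ab => out; apply: inside; exists l => //; left; right.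
have y_ab i l : a <= y i l w <= b.
  apply: in_ab => out; apply: inside; exists l => //; right.
  by rewrite (bigD1 i)//=; left.
have cx1 l : c (x1 l w) = x1 l w by exact: clamp_id.
have cx2 l : c (x2 l w) = x2 l w by exact: clamp_id.
have cy i l : c (y i l w) = y i l w by exact: clamp_id.
split => //=.
- move=> i m; rewrite ltNge; apply/negP => dev; apply: (close (inl i)).
  exists m => //=; under eq_bigr do rewrite cy.
  exact: dev.
- move=> m; apply: ltW; rewrite ltNge; apply/negP => dev.
  apply: (close (inr ord0)); exists m => //=.
  by under eq_bigr do rewrite cx1.
- move=> m; apply: ltW; rewrite ltNge; apply/negP => dev.
  apply: (close (inr (inord 1))); rewrite /deviates inordK//.
  exists m => //=; under eq_bigr do rewrite cx2.
  exact: dev.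
- move=> m; apply: ltW; rewrite ltNge; apply/negP => dev.
  apply: (close (inr ord_max)); exists m => //=.
  under eq_bigr do rewrite cx1 cx2.
  exact: dev.
- by move=> l; rewrite x1_ab x2_ab.
- by move=> i; exact: mean_bounded.
Qed.

Lemma probability_ge_off_failure (S : set T) : measurable S -> ~` failure `<=` S ->
  ((1 - delta)%:E <= P S)%E.
Proof.
move=> mS sub; apply: (@le_trans _ _ (P (~` failure))).
  rewrite probability_setC; last exact: measurable_failure.
  by rewrite EFinB leeB// failure_le.
by apply: le_measure => //; rewrite inE//; apply: measurableC; exact: measurable_failure.
Qed.

End good_event.

Theorem theorem1 (R : realType) (n : nat) (n_gt0 : (0 < n)%N)
    (a b k delta : R) (a_ge0 : 0 <= a) (ab : a < b) (k_ge0 : 0 <= k)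
    (delta_gt0 : 0 < delta)
    (nu : 'I_n -> probability (measurableTypeR R) R)
    (nu_bounded : forall i, nu i `[a, b]%classic = 1%E)
    (d : measure_display) (T : measurableType d) (P : probability T R)
    (A : nat -> T -> 'I_n) (x1 x2 : nat -> {RV P >-> R})
    (y : 'I_n -> nat -> {RV P >-> R})
    (samples : sampling nu A x1 x2 y) :
  let returns (w : T) (O : {set 'I_n}) :=
    ADE_returns a b k delta (fun l => (x1 l w, x2 l w)) (fun i l => y i l w) O in
  ((1 - delta)%:E <= P [set w | forall O, returns w O -> O = outliers nu k])%E
  /\
  ((forall i, arm_mean nu i <> threshold nu k) ->
   ((1 - delta)%:E <= P [set w | returns w (outliers nu k)])%E).
Proof.
(* For delta >= 1 the bound is at most 0; below 1 every logarithm in the radii is positive. *)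
have [delta_ge1|delta_lt1] := leP 1 delta.
  by move=> returns; split=> [|_]; apply: (@le_trans _ _ 0%E) => //;
    rewrite lee_fin subr_le0.
have delta01 : 0 < delta < 1 by rewrite delta_gt0.
have mx1 l : measurable_fun setT (x1 l) by exact: measurable_funPT.
have mx2 l : measurable_fun setT (x2 l) by exact: measurable_funPT.
have my i l : measurable_fun setT (y i l) by exact: measurable_funPT.
have good := not_failure_concentrated ab nu_bounded.
move=> returns; split=> [|sep].
  apply: (probability_ge_off_failure a_ge0 ab delta01 nu_bounded samples).
    exact: (measurable_only_returns a b k delta mx1 mx2 my).
  move=> w /good conc O.
  exact: (ADE_returns_correct n_gt0 a_ge0 ab k_ge0 delta01 conc).
apply: (probability_ge_off_failure a_ge0 ab delta01 nu_bounded samples).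
  exact: (measurable_ADE_returns a b k delta mx1 mx2 my).
move=> w /good conc.
exact: (ADE_returns_outliers n_gt0 a_ge0 ab k_ge0 delta01 conc sep).
Qed.
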